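(* Let $\mathcal A$ be a Krull–Schmidt abelian category and let $f_!\dashv f^*$ be an adjunction with Nakayama functor $\nu$, where $f^*:\mathcal A\to\mathcal C$. Assume that $f_!\dashv f^*$ is Iwanaga–Gorenstein of dimension $n\le1$. Let $0\to A''\xrightarrow{g'}A\xrightarrow{g}A'\to0$ be an almost split sequence in $\mathcal A$. (i) If $A'$ is an indecomposable object of $\mathcal G_{f_*}\mathrm{inj}$ which is not projective in $\mathcal G_{f_*}\mathrm{inj}$, then the sequence $0\to\nu^-(A'')\xrightarrow{\nu^-(g')}\nu^-(A)\xrightarrow{\nu^-(g)}\nu^-(A')\to0$ is exact, and is a direct sum of an almost split sequence in $\mathcal G_{f_!}\mathrm{proj}$ and a sequence of the form $0\to A'''\xrightarrow{1}A'''\to0\to0$ in $\mathcal G_{f_!}\mathrm{proj}$. (ii) If $A'$ is an indecomposable object of $\mathcal G_{f_*}\mathrm{inj}$ which is not projective in $\mathcal G_{f_*}\mathrm{inj}$, then the sequence $0\to\nu\nu^-(A'')\xrightarrow{\nu\nu^-(g')}\nu\nu^-(A)\xrightarrow{g\circ\varepsilon_A}A'\to0$, where $\varepsilon:\nu\nu^-\to\operatorname{Id}$ is the counit of $\nu\dashv\nu^-$, is exact, and is a direct sum of an almost split sequence in $\mathcal G_{f_*}\mathrm{inj}$ and a sequence of the form $0\to A'''\xrightarrow{1}A'''\to0\to0$ in $\mathcal G_{f_*}\mathrm{inj}$. The dual results hold for $\nu$: if $A''$ is an indecomposable object of $\mathcal G_{f_!}\mathrm{proj}$ which is not injective in $\mathcal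 G_{f_!}\mathrm{proj}$, then $0\to\nu(A'')\to\nu(A)\to\nu(A')\to0$ is exact and is a direct sum of an almost split sequence and a sequence of the form $0\to0\to A'''\xrightarrow{1}A'''\to0$ in $\mathcal G_{f_*}\mathrm{inj}$; and $0\to A''\xrightarrow{\eta_A\circ g'}\nu^-\nu(A)\xrightarrow{\nu^-\nu(g)}\nu^-\nu(A')\to0$, with $\eta$ the unit of $\nu\dashv\nu^-$, is exact and is a direct sum of an almost split sequence and a sequence of the form $0\to0\to A'''\xrightarrow{1}A'''\to0$ in $\mathcal G_{f_!}\mathrm{proj}$.
   Context: All functors are additive. Let $\mathcal A,\mathcal C$ be abelian categories and $f^*:\mathcal A\to\mathcal C$ a faithful functor with left adjoint $f_!:\mathcal C\to\mathcal A$. A Nakayama functor with respect to $f_!\dashv f^*$ is a functor $\nu:\mathcal A\to\mathcal A$ with a right adjoint $\nu^-:\mathcal A\to\mathcal A$ such that (a) $\nu\circ f_!$ is right adjoint to $f^*$, and (b) the unit of $\nu\dashv\nu^-$ induces a natural isomorphism $f_!\to\nu^-\circ\nu\circ f_!$. Put $f_*:=\nu\circ f_!$. Relative projective (resp. relative injective) objects of $\mathcal A$ are direct summands of objects in the essential image of $f_!$ (resp. $f_*$). $\mathcal G_{f_!}\mathrm{proj}$ is the full subcategory of $\mathcal A$ of objects $\operatorname{Ker}(Q_0\to Q_{-1})$ for exact complexes $Q_\bullet=\cdots\to Q_1\to Q_0\to Q_{-1}\to\cdots$ of relative projectives with $\nu(Q_\bullet)$ exact. $\mathcal G_{f_*}\mathrm{inj}$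 is the full subcategory of objects $\operatorname{Ker}(J_0\to J_{-1})$ for exact complexes $J_\bullet$ of relative injectives with $\nu^-(J_\bullet)$ exact. Both are extension-closed, hence exact categories; ''projective/injective in'' refers to this exact structure. The derived functors $L_j\nu$ and $R^j\nu^-$ exist and are computed by resolutions by relative projectives, resp. coresolutions by relative injectives. The adjunction is Iwanaga–Gorenstein if there is an integer $n$ with $L_j\nu=0$ and $R^j\nu^-=0$ for all $j>n$; its dimension is the smallest such $n$. Krull–Schmidt: every object is a finite direct sum of objects with local endomorphism rings. A morphism $g:A\to A'$ in a category is right almost split if it is not a split epimorphism and every morphism $B\to A'$ which is not a split epimorphism factors through $g$; left almost split is dual. An exact sequence $0\to L\xrightarrow{f}M\xrightarrow{g}N\to0$ in an extension-closed subcategory of an abelian category is almost split if $f$ is left almost split and $g$ is right almost split in the subcategory. *)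

(* Defs.v *)
From HB Require Import structures.
From mathcomp Require Import all_boot ssralg ssrint.

Set Implicit Arguments.
Unset Strict Implicit.
Unset Printing Implicit Defensive.

Import GRing.Theory.
Local Open Scope ring_scope.

Record preadditive := Preadditive {
  obj :> Type;
  mor : obj -> obj -> zmodType;
  idm : forall X, mor X X;
  compm : forall X Y Z, mor Y Z -> mor X Y -> mor X Z;
  comp_idl : forall X Y (f : mor X Y), compm (idm Y) f = f;
  comp_idr : forall X Y (f : mor X Y), compm f (idm X) = f;
  comp_assoc : forall X Y Z W (h : mor Z W) (g : mor Y Z) (f : mor X Y),
    compm h (compm g f) = compm (compm h g) f;
  comp_addl : forall X Y Z (g g' : mor Y Z) (f : mor X Y),
    compm (g + g') f = compm g f + compm g' f;
  comp_addr : forall X Y Z (g : mor Y Z) (f f' : mor X Y),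
    compm g (f + f') = compm g f + compm g f'
}.

Arguments mor {_} X Y.
Arguments idm {_} X.
Arguments compm {_ X Y Z} g f.

Notation "g \oc f" := (compm g f) (at level 40, left associativity).

Section Morphisms.
Variable A : preadditive.
Implicit Types X Y Z K S : A.

Definition mono X Y (f : mor X Y) :=
  forall T (u v : mor T X), f \oc u = f \oc v -> u = v.

Definition epi X Y (f : mor X Y) :=
  forall T (u v : mor Y T), u \oc f = v \oc f -> u = v.

Definition split_mono X Y (f : mor X Y) := exists r : mor Y X, r \oc f = idm X.

Definition split_epi X Y (f : mor X Y) := exists s : mor Y X, f \oc s = idm Y.

Definition is_iso X Y (f : mor X Y) :=
  exists g : mor Y X, g \oc f = idm X /\ f \oc g = idm Y.

Definition isomorphic X Y := exists f : mor X Y, is_iso f.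

Definition is_zero Z :=
  (forall X (f : mor X Z), f = 0) /\ (forall Y (f : mor Z Y), f = 0).

Definition is_kernel K X Y (k : mor K X) (f : mor X Y) :=
  f \oc k = 0 /\
  forall T (t : mor T X), f \oc t = 0 -> exists! u : mor T K, k \oc u = t.

Definition is_cokernel X Y Q (q : mor Y Q) (f : mor X Y) :=
  q \oc f = 0 /\
  forall T (t : mor Y T), t \oc f = 0 -> exists! u : mor Q T, u \oc q = t.

Definition is_biproduct X Y S
    (i1 : mor X S) (i2 : mor Y S) (p1 : mor S X) (p2 : mor S Y) :=
  [/\ p1 \oc i1 = idm X, p2 \oc i2 = idm Y, p1 \oc i2 = 0, p2 \oc i1 = 0
    & i1 \oc p1 + i2 \oc p2 = idm S].

Definition is_direct_sum X Y S :=
  exists (i1 : mor X S) (i2 : mor Y S) (p1 : mor S X) (p2 : mor S Y),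
    is_biproduct i1 i2 p1 p2.

Definition is_finite_direct_sum (n : nat) (X : 'I_n -> A) S :=
  exists (i : forall j, mor (X j) S) (p : forall j, mor S (X j)),
    [/\ forall j, p j \oc i j = idm (X j),
        forall j k, j != k -> p j \oc i k = 0
      & \sum_j (i j \oc p j) = idm S].

Definition direct_summand X S := exists Y, is_direct_sum X Y S.

Definition indecomposable X :=
  ~ is_zero X /\ forall Y Z, is_direct_sum Y Z X -> is_zero Y \/ is_zero Z.

(* A ring is local when it is nonzero and the sum of two non-units is a
   non-unit; here the ring is End(X). *)
Definition local_end X :=
  idm X <> 0 /\
  forall a b : mor X X, ~ is_iso a -> ~ is_iso b -> ~ is_iso (a + b).

(* The image of f is the kernel of g: f is an epimorphism followed by a
   kernel of g. *)
Definition exact_at X Y Z (f : mor X Y) (g : mor Y Z) :=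
  exists K (k : mor K Y) (e : mor X K),
    [/\ is_kernel k g, epi e & f = k \oc e].

Definition short_exact L M N (f : mor L M) (g : mor M N) :=
  [/\ mono f, exact_at f g & epi g].

(* H is Ker g / Im f. *)
Definition is_homology X Y Z (f : mor X Y) (g : mor Y Z) H :=
  exists K (k : mor K Y) (e : mor X K) (c : mor K H),
    [/\ is_kernel k g, k \oc e = f & is_cokernel c e].

End Morphisms.

Record abelian_cat (A : preadditive) : Prop := AbelianCat {
  has_zero : exists Z : A, is_zero Z;
  has_biproducts : forall X Y : A, exists S, is_direct_sum X Y S;
  has_kernels : forall (X Y : A) (f : mor X Y),
    exists K (k : mor K X), is_kernel k f;
  has_cokernels : forall (X Y : A) (f : mor X Y),
    exists Q (q : mor Y Q), is_cokernel q f;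
  mono_normal : forall (X Y : A) (f : mor X Y), mono f ->
    exists Z (g : mor Y Z), is_kernel f g;
  epi_normal : forall (X Y : A) (f : mor X Y), epi f ->
    exists W (g : mor W X), is_cokernel f g
}.

Definition krull_schmidt (A : preadditive) :=
  forall S : A, exists (n : nat) (X : 'I_n -> A),
    is_finite_direct_sum X S /\ forall j, local_end (X j).

Record functor (A B : preadditive) := Functor {
  fobj :> A -> B;
  fmap : forall X Y : A, {additive mor X Y -> mor (fobj X) (fobj Y)};
  fmap1 : forall X : A, fmap X X (idm X) = idm (fobj X);
  fmap_comp : forall (X Y Z : A) (g : mor Y Z) (f : mor X Y),
    fmap X Z (g \oc f) = fmap Y Z g \oc fmap X Y f
}.

Arguments fmap {A B} _ {X Y}.

Section FunctorComposition.
Variables (A B C : preadditive) (G : functor B C) (F : functor A B).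

Lemma fcomp_map1 (X : A) :
  (fmap G \o fmap F : {additive _ -> _}) (idm X) = idm (G (F X)).
Proof. by rewrite /= !fmap1. Qed.

Lemma fcomp_map_comp (X Y Z : A) (g : mor Y Z) (f : mor X Y) :
  (fmap G \o fmap F : {additive _ -> _}) (g \oc f) =
  (fmap G \o fmap F : {additive _ -> _}) g
    \oc (fmap G \o fmap F : {additive _ -> _}) f.
Proof. by rewrite /= !fmap_comp. Qed.

Definition fcomp : functor A C :=
  @Functor A C (fun X => G (F X))
    (fun X Y => (fmap G \o fmap F : {additive mor X Y -> _}))
    fcomp_map1 fcomp_map_comp.

End FunctorComposition.

Definition faithful (A B : preadditive) (F : functor A B) :=
  forall (X Y : A) (u v : mor X Y), fmap F u = fmap F v -> u = v.

(* L is left adjoint to R. *)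
Record adjunction (A B : preadditive) (L : functor A B) (R : functor B A) :=
  Adjunction {
  adj_unit : forall X : A, mor X (R (L X));
  adj_counit : forall Y : B, mor (L (R Y)) Y;
  adj_unit_natural : forall (X X' : A) (u : mor X X'),
    adj_unit X' \oc u = fmap R (fmap L u) \oc adj_unit X;
  adj_counit_natural : forall (Y Y' : B) (v : mor Y Y'),
    v \oc adj_counit Y = adj_counit Y' \oc fmap L (fmap R v);
  triangle_left : forall X : A, adj_counit (L X) \oc fmap L (adj_unit X) = idm (L X);
  triangle_right : forall Y : B, fmap R (adj_counit Y) \oc adj_unit (R Y) = idm (R Y)
}.

(* nu is the Nakayama functor and num its right adjoint nu^-; fshriek is f_!,
   fstar is f^*, and f_* is fcomp nu fshriek. *)
Record nakayama (A C : preadditive) (fshriek : functor C A) (fstar : functor A C)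
    (adj : adjunction fshriek fstar) := Nakayama {
  nu : functor A A;
  num : functor A A;
  nu_adj : adjunction nu num;
  nu_fshriek_right_adjoint : inhabited (adjunction fstar (fcomp nu fshriek));
  nu_unit_iso : forall X : C, is_iso (adj_unit nu_adj (fshriek X))
}.

(* Homological indexing; the degree shift n + 1 makes consecutive
   differentials composable without transport along equalities of integers,
   and n ranging over all of int covers every spot of the complex. *)
Record complex (A : preadditive) := Complex {
  cobj :> int -> A;
  cdiff : forall n : int, mor (cobj (n + 1)) (cobj n);
  cdiff_cdiff : forall n : int, cdiff n \oc cdiff (n + 1) = 0
}.

Lemma map_diff_diff (A B : preadditive) (F : functor A B) (Q : complex A) n :
  fmap F (cdiff Q n) \oc fmap F (cdiff Q (n + 1)) = 0.
Proof. by rewrite -fmap_comp cdiff_cdiff raddf0. Qed.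

Definition map_complex (A B : preadditive) (F : functor A B) (Q : complex A) :
    complex B :=
  @Complex B (fun n => F (Q n)) (fun n => fmap F (cdiff Q n))
    (map_diff_diff F Q).

Definition exact_complex (A : preadditive) (Q : complex A) :=
  forall n : int, exact_at (cdiff Q (n + 1)) (cdiff Q n).

Definition add_image (A C : preadditive) (F : functor C A) (X : A) :=
  exists (Y : A) (c : C), isomorphic Y (F c) /\ direct_summand X Y.

Section Relative.
Variables (A C : preadditive) (fshriek : functor C A) (fstar : functor A C).
Variables (adj : adjunction fshriek fstar) (N : nakayama adj).

Definition rel_proj (X : A) := add_image fshriek X.

Definition rel_inj (X : A) := add_image (fcomp (nu N) fshriek) X.

Definition Gproj (X : A) := exists Q : complex A,
  [/\ forall n, rel_proj (Q n), exact_complex Q,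
      exact_complex (map_complex (nu N) Q)
    & exists k : mor X (Q (-1 + 1)), is_kernel k (cdiff Q (-1))].

Definition Ginj (X : A) := exists J : complex A,
  [/\ forall n, rel_inj (J n), exact_complex J,
      exact_complex (map_complex (num N) J)
    & exists k : mor X (J (-1 + 1)), is_kernel k (cdiff J (-1))].

Definition rel_proj_resolution (X : A) (P : nat -> A)
    (d : forall m, mor (P m.+1) (P m)) (a : mor (P 0%N) X) :=
  [/\ forall m, rel_proj (P m), epi a, exact_at (d 0%N) a
    & forall m, exact_at (d m.+1) (d m)].

Definition rel_inj_coresolution (X : A) (I : nat -> A)
    (d : forall m, mor (I m) (I m.+1)) (a : mor X (I 0%N)) :=
  [/\ forall m, rel_inj (I m), mono a, exact_at a (d 0%N)
    & forall m, exact_at (d m) (d m.+1)].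

(* H is (a representative of) the value L_j nu (X). Relative projectives need
   not be projective, but they are acyclic for nu and, fstar being faithful,
   every X is covered by fshriek (fstar X); so such resolutions exist and H is
   determined up to isomorphism. Dually for R^j num. *)
Definition left_derived_nu (j : nat) (X H : A) :=
  exists (P : nat -> A) (d : forall m, mor (P m.+1) (P m)) (a : mor (P 0%N) X),
    rel_proj_resolution d a /\
    match j with
    | 0 => exists q : mor (nu N (P 0%N)) H, is_cokernel q (fmap (nu N) (d 0%N))
    | i.+1 => is_homology (fmap (nu N) (d i.+1)) (fmap (nu N) (d i)) H
    end.

Definition right_derived_num (j : nat) (X H : A) :=
  exists (I : nat -> A) (d : forall m, mor (I m) (I m.+1)) (a : mor X (I 0%N)),
    rel_inj_coresolution d a /\
    match j with
    | 0 => exists k : mor H (num N (I 0%N)), is_kernel k (fmap (num N) (d 0%N))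
    | i.+1 => is_homology (fmap (num N) (d i)) (fmap (num N) (d i.+1)) H
    end.

Definition derived_vanish_above (n : nat) :=
  forall (j : nat) (X H : A), (n < j)%N ->
    (left_derived_nu j X H -> is_zero H) /\
    (right_derived_num j X H -> is_zero H).

Definition iwanaga_gorenstein_dim (n : nat) :=
  derived_vanish_above n /\
  forall m : nat, derived_vanish_above m -> (n <= m)%N.

End Relative.

Section FullSubcategory.
(* P is the object predicate of a full subcategory of A; when it is closed
   under extensions, its conflations are the short exact sequences of A with
   all three terms in P. *)
Variables (A : preadditive) (P : A -> Prop).

Definition conflation (L M N : A) (f : mor L M) (g : mor M N) :=
  [/\ P L, P M, P N & short_exact f g].

Definition projective_in (X : A) :=
  P X /\ forall (L M N : A) (f : mor L M) (g : mor M N), conflation f g ->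
    forall h : mor X N, exists u : mor X M, g \oc u = h.

Definition injective_in (X : A) :=
  P X /\ forall (L M N : A) (f : mor L M) (g : mor M N), conflation f g ->
    forall h : mor L X, exists u : mor M X, u \oc f = h.

Definition right_almost_split (M N : A) (g : mor M N) :=
  ~ split_epi g /\
  forall B (h : mor B N), P B -> ~ split_epi h ->
    exists u : mor B M, g \oc u = h.

Definition left_almost_split (L M : A) (f : mor L M) :=
  ~ split_mono f /\
  forall B (h : mor L B), P B -> ~ split_mono h ->
    exists u : mor M B, u \oc f = h.

Definition almost_split_sequence (L M N : A) (f : mor L M) (g : mor M N) :=
  [/\ conflation f g, left_almost_split f & right_almost_split g].

End FullSubcategory.

(* The sequence (f, g) is isomorphic to the direct sum of (f1, g1) and
   (f2, g2). *)
Definition is_direct_sum_seq (A : preadditive)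
    (L1 M1 N1 : A) (f1 : mor L1 M1) (g1 : mor M1 N1)
    (L2 M2 N2 : A) (f2 : mor L2 M2) (g2 : mor M2 N2)
    (L M N : A) (f : mor L M) (g : mor M N) :=
  exists (iL1 : mor L1 L) (iL2 : mor L2 L) (pL1 : mor L L1) (pL2 : mor L L2)
         (iM1 : mor M1 M) (iM2 : mor M2 M) (pM1 : mor M M1) (pM2 : mor M M2)
         (iN1 : mor N1 N) (iN2 : mor N2 N) (pN1 : mor N N1) (pN2 : mor N N2),
    [/\ is_biproduct iL1 iL2 pL1 pL2,
        is_biproduct iM1 iM2 pM1 pM2,
        is_biproduct iN1 iN2 pN1 pN2,
        f \oc iL1 = iM1 \oc f1 /\ f \oc iL2 = iM2 \oc f2
      & g \oc iM1 = iN1 \oc g1 /\ g \oc iM2 = iN2 \oc g2].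

(* (f, g) is an almost split sequence in P plus 0 -> T = T -> 0 -> 0. *)
Definition almost_split_plus_left (A : preadditive) (P : A -> Prop)
    (L M N : A) (f : mor L M) (g : mor M N) :=
  exists (L1 M1 N1 : A) (f1 : mor L1 M1) (g1 : mor M1 N1) (T Z : A),
    [/\ almost_split_sequence P f1 g1, P T, is_zero Z
      & is_direct_sum_seq f1 g1 (idm T) (0 : mor T Z) f g].

(* (f, g) is an almost split sequence in P plus 0 -> 0 -> T = T -> 0. *)
Definition almost_split_plus_right (A : preadditive) (P : A -> Prop)
    (L M N : A) (f : mor L M) (g : mor M N) :=
  exists (L1 M1 N1 : A) (f1 : mor L1 M1) (g1 : mor M1 N1) (T Z : A),
    [/\ almost_split_sequence P f1 g1, P T, is_zero Z
      & is_direct_sum_seq f1 g1 (0 : mor Z T) (idm T) f g].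

(* Main.v *)
(* In dimension at most 1 the Gorenstein projectives are exactly the subobjects
   of relative projectives, and the Gorenstein injectives the quotients of
   relative injectives: L_1 nu vanishes on the former and R^1 nu^- on the
   latter, nu and nu^- restrict to mutually inverse exact equivalences between
   them, and nu^- (resp. nu) sends every object of A to the former (resp. the
   latter). If g : A -> A' is right almost split and A' is Gorenstein injective,
   the adjunction therefore makes nu^-(g), and likewise g composed with the
   counit, right almost split among the Gorenstein projectives (injectives).
   As A' is not projective there, some non-split epimorphism onto nu^-(A')
   factors through nu^-(g), which is thus an epimorphism. In a Krull-Schmidt
   category a right almost split epimorphism is right minimal up to a summand on
   which it vanishes, and the kernel of a right minimal one is left almost split.
   The statements for nu follow by passing to the opposite category. *)
Require Import Defs.
From HB Require Import structures.
From mathcomp Require Import all_boot ssralg ssrint.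
From Stdlib Require Import ClassicalEpsilon.

Set Implicit Arguments.
Unset Strict Implicit.
Unset Printing Implicit Defensive.

Import GRing.Theory.
Local Open Scope ring_scope.

(** * Preadditive and abelian categories *)

Section Additive.
Variable A : preadditive.
Implicit Types X Y Z W : A.

Lemma comp0m X Y Z (f : mor X Y) : (0 : mor Y Z) \oc f = 0.
Proof. by apply: (addrI (0 \oc f)); rewrite -comp_addl !addr0. Qed.

Lemma compm0 X Y Z (f : mor Y Z) : f \oc (0 : mor X Y) = 0.
Proof. by apply: (addrI (f \oc 0)); rewrite -comp_addr !addr0. Qed.

Lemma compNm X Y Z (g : mor Y Z) (f : mor X Y) : (- g) \oc f = - (g \oc f).
Proof. by apply: (addrI (g \oc f)); rewrite -comp_addl !subrr comp0m. Qed.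

Lemma compmN X Y Z (g : mor Y Z) (f : mor X Y) : g \oc (- f) = - (g \oc f).
Proof. by apply: (addrI (g \oc f)); rewrite -comp_addr !subrr compm0. Qed.

Lemma compBm X Y Z (g h : mor Y Z) (f : mor X Y) :
  (g - h) \oc f = g \oc f - h \oc f.
Proof. by rewrite comp_addl compNm. Qed.

Lemma compmB X Y Z (g : mor Y Z) (f h : mor X Y) :
  g \oc (f - h) = g \oc f - g \oc h.
Proof. by rewrite comp_addr compmN. Qed.

Lemma comp_suml X Y Z I (r : seq I) (g : I -> mor Y Z) (f : mor X Y) :
  (\sum_(i <- r) g i) \oc f = \sum_(i <- r) (g i \oc f).
Proof.
elim: r => [|i r IH]; first by rewrite !big_nil comp0m.
by rewrite !big_cons comp_addl IH.
Qed.

Lemma comp_sumr X Y Z I (r : seq I) (g : mor Y Z) (f : I -> mor X Y) :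
  g \oc (\sum_(i <- r) f i) = \sum_(i <- r) (g \oc f i).
Proof.
elim: r => [|i r IH]; first by rewrite !big_nil compm0.
by rewrite !big_cons comp_addr IH.
Qed.

Lemma compm_eq X Y Z W (k : mor Z W) (g : mor Y Z) (f : mor X Y) h :
  g \oc f = h -> k \oc g \oc f = k \oc h.
Proof. by move=> <-; rewrite comp_assoc. Qed.

Lemma mono0P X Y (f : mor X Y) :
  (forall T (t : mor T X), f \oc t = 0 -> t = 0) -> mono f.
Proof.
move=> f0 T u v fuv; apply/eqP; rewrite -subr_eq0; apply/eqP/f0.
by rewrite compmB fuv subrr.
Qed.

Lemma mono0 X Y (f : mor X Y) T (t : mor T X) : mono f -> f \oc t = 0 -> t = 0.
Proof. by move=> mf ft; apply: mf; rewrite ft compm0. Qed.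

Lemma epi0 X Y (f : mor X Y) T (t : mor Y T) : epi f -> t \oc f = 0 -> t = 0.
Proof. by move=> mf ft; apply: mf; rewrite ft comp0m. Qed.

Lemma epi0P X Y (f : mor X Y) :
  (forall T (t : mor Y T), t \oc f = 0 -> t = 0) -> epi f.
Proof.
move=> f0 T u v fuv; apply/eqP; rewrite -subr_eq0; apply/eqP/f0.
by rewrite compBm fuv subrr.
Qed.

Lemma mono_comp X Y Z (g : mor Y Z) (f : mor X Y) :
  mono g -> mono f -> mono (g \oc f).
Proof. by move=> mg mf T u v; rewrite -!comp_assoc => /mg/mf. Qed.

Lemma epi_comp X Y Z (g : mor Y Z) (f : mor X Y) :
  epi g -> epi f -> epi (g \oc f).
Proof. by move=> mg mf T u v; rewrite !comp_assoc => /mf/mg. Qed.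

Lemma mono_compr X Y Z (g : mor Y Z) (f : mor X Y) : mono (g \oc f) -> mono f.
Proof. by move=> m T u v fuv; apply: m; rewrite -!comp_assoc fuv. Qed.

Lemma epi_compl X Y Z (g : mor Y Z) (f : mor X Y) : epi (g \oc f) -> epi g.
Proof. by move=> m T u v fuv; apply: m; rewrite !comp_assoc fuv. Qed.

Lemma is_iso_id X : is_iso (idm X).
Proof. by exists (idm X); rewrite comp_idl. Qed.

Lemma iso_mono X Y (f : mor X Y) : is_iso f -> mono f.
Proof.
move=> [g [gf _]] T u v fuv.
by rewrite -(comp_idl u) -(comp_idl v) -gf -!comp_assoc fuv.
Qed.

Lemma iso_epi X Y (f : mor X Y) : is_iso f -> epi f.
Proof.
move=> [g [_ fg]] T u v fuv.
by rewrite -(comp_idr u) -(comp_idr v) -fg !comp_assoc fuv.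
Qed.

Lemma iso_comp X Y Z (g : mor Y Z) (f : mor X Y) :
  is_iso g -> is_iso f -> is_iso (g \oc f).
Proof.
move=> [g1 [g1g gg1]] [f1 [f1f ff1]]; exists (f1 \oc g1).
by rewrite !comp_assoc (compm_eq _ g1g) (compm_eq _ ff1) !comp_idr.
Qed.

Lemma isoP_lr X Y (f : mor X Y) (g h : mor Y X) :
  g \oc f = idm X -> f \oc h = idm Y -> is_iso f.
Proof.
move=> gf fh; exists g; split=> //.
suff -> : g = h by [].
by rewrite -(comp_idr g) -fh comp_assoc gf comp_idl.
Qed.

Lemma kernel_mono K X Y (k : mor K X) (f : mor X Y) : is_kernel k f -> mono k.
Proof.
move=> [fk kU] T u v kuv; have [|w [_ wU]] := kU _ (k \oc v).
  by rewrite comp_assoc fk comp0m.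
by rewrite -(wU u kuv) -(wU v erefl).
Qed.

Lemma cokernel_epi Q X Y (q : mor Y Q) (f : mor X Y) : is_cokernel q f -> epi q.
Proof.
move=> [fk kU] T u v kuv; have [|w [_ wU]] := kU _ (v \oc q).
  by rewrite -comp_assoc fk compm0.
by rewrite -(wU u kuv) -(wU v erefl).
Qed.

Lemma kernel_lift K X Y (k : mor K X) (f : mor X Y) T (t : mor T X) :
  is_kernel k f -> f \oc t = 0 -> exists u, k \oc u = t.
Proof. by move=> [_ kU] /kU [u [ku _]]; exists u. Qed.

Lemma cokernel_desc Q X Y (q : mor Y Q) (f : mor X Y) T (t : mor Y T) :
  is_cokernel q f -> t \oc f = 0 -> exists u, u \oc q = t.
Proof. by move=> [_ kU] /kU [u [ku _]]; exists u. Qed.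

Lemma kernelP K X Y (k : mor K X) (f : mor X Y) :
  f \oc k = 0 -> mono k ->
  (forall T (t : mor T X), f \oc t = 0 -> exists u, k \oc u = t) ->
  is_kernel k f.
Proof.
move=> fk mk L; split=> // T t /L [u ku]; exists u; split=> // v kv.
by apply: mk; rewrite ku kv.
Qed.

Lemma cokernelP Q X Y (q : mor Y Q) (f : mor X Y) :
  q \oc f = 0 -> epi q ->
  (forall T (t : mor Y T), t \oc f = 0 -> exists u, u \oc q = t) ->
  is_cokernel q f.
Proof.
move=> fk mk L; split=> // T t /L [u ku]; exists u; split=> // v kv.
by apply: mk; rewrite ku kv.
Qed.

Lemma kernel_mono_comp K X Y Z (k : mor K X) (f : mor X Y) (m : mor Y Z) :
  mono m -> is_kernel k (m \oc f) <-> is_kernel k f.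
Proof.
move=> mm; split=> ker; apply: kernelP (kernel_mono ker) _.
- by apply: (mono0 mm); rewrite comp_assoc; case: ker.
- by move=> T t ft; apply: (kernel_lift ker); rewrite -comp_assoc ft compm0.
- by rewrite -comp_assoc (proj1 ker) compm0.
- by move=> T t; rewrite -comp_assoc => /(mono0 mm) /(kernel_lift ker).
Qed.

Lemma kernel_iso K K' X Y (k : mor K X) (f : mor X Y) (w : mor K' K) :
  is_iso w -> is_kernel k f -> is_kernel (k \oc w) f.
Proof.
move=> iw ker; apply: kernelP.
- by rewrite comp_assoc (proj1 ker) comp0m.
- by apply: mono_comp (kernel_mono ker) (iso_mono iw).
- move=> T t /(kernel_lift ker) [u <-]; case: iw => v [_ wv].
  by exists (v \oc u); rewrite -comp_assoc (comp_assoc w) wv comp_idl.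
Qed.

(** A form of [short_exact] that is self-dual by symmetry of its two halves; [short_exactP]
    identifies the two in an abelian category. *)
Definition ses (L M N : A) (f : mor L M) (g : mor M N) :=
  is_kernel f g /\ is_cokernel g f.

End Additive.

(** * Opposite categories, functors and adjunctions *)

(** Over [op A], [mono] and [is_kernel] are convertible to [epi] and [is_cokernel] over [A], so many
    dual lemmas follow by plain application. Notions whose components get permuted, such as
    [is_iso], need the transfer lemmas below. *)
Definition op (A : preadditive) : preadditive :=
  @Preadditive A (fun X Y => mor Y X) (fun X => idm X)
    (fun X Y Z g f => f \oc g)
    (fun X Y f => comp_idr f) (fun X Y f => comp_idl f)
    (fun X Y Z W h g f => esym (comp_assoc f g h))
    (fun X Y Z g g' f => comp_addr f g g')
    (fun X Y Z g f f' => comp_addl f f' g).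

Definition op_functor (A B : preadditive) (F : functor A B) :
    functor (op A) (op B) :=
  @Functor (op A) (op B) F (fun X Y => @fmap A B F Y X) (fun X => fmap1 F X)
    (fun X Y Z g f => fmap_comp F f g).

Definition op_adjunction (A B : preadditive) (L : functor A B)
    (R : functor B A) (a : adjunction L R) :
    adjunction (op_functor R) (op_functor L) :=
  @Adjunction (op B) (op A) (op_functor R) (op_functor L)
    (fun X => adj_counit a X) (fun Y => adj_unit a Y)
    (fun X X' u => adj_counit_natural a u) (fun Y Y' v => adj_unit_natural a v)
    (fun X => triangle_right a X) (fun Y => triangle_left a Y).

Section OpLemmas.
Variable A : preadditive.

Lemma op_direct_sum (X Y S : A) :
  is_direct_sum (A := op A) X Y S <-> is_direct_sum X Y S.
Proof.
by split=> -[i1 [i2 [p1 [p2 []]]]] *; exists p1, p2, i1, i2; split.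
Qed.

Lemma op_iso (X Y : A) (f : mor X Y) :
  is_iso (A := op A) (f : @mor (op A) Y X) <-> is_iso f.
Proof. by split=> -[g [? ?]]; exists g; split. Qed.

Lemma op_zero (Z : A) : is_zero (A := op A) Z <-> is_zero Z.
Proof. by split=> -[? ?]; split. Qed.

Lemma op_abelian : abelian_cat A -> abelian_cat (op A).
Proof.
case=> [[Z Z0] bip ker coker mn en]; split.
- by exists Z; apply/op_zero.
- by move=> X Y; have [S] := bip X Y => /(op_direct_sum); exists S.
- by move=> X Y f; apply: coker.
- by move=> X Y f; apply: ker.
- by move=> X Y f; apply: en.
- by move=> X Y f; apply: mn.
Qed.

Lemma op_krull_schmidt : krull_schmidt A -> krull_schmidt (op A).
Proof.
move=> ks S; have [n [X [[i [p [pi pi0 sum]]] loc]]] := ks S.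
exists n, X; split.
  by exists p, i; split=> // j k jk; apply: pi0; rewrite eq_sym.
move=> j; have [id0 add] := loc j; split=> // a b na nb /op_iso.
by apply: add => /op_iso.
Qed.

End OpLemmas.

(** * Exactness in abelian categories by generalized elements *)

Section Abelian.
Variable A : preadditive.
Hypothesis abA : abelian_cat A.
Implicit Types K L M N Q T X Y Z : A.

Lemma mono_epi_iso X Y (f : mor X Y) : mono f -> epi f -> is_iso f.
Proof.
move=> mf ef; have [Z [g ker]] := mono_normal abA mf.
have g0 : g = 0 by apply: (epi0 ef); case: ker.
have [|r fr] := kernel_lift (t := idm Y) ker; first by rewrite g0 comp0m.
exists r; split=> //; apply: mf.
by rewrite comp_assoc fr comp_idl comp_idr.
Qed.

Lemma epi_cokernel K X Y (k : mor K X) (f : mor X Y) :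
  epi f -> is_kernel k f -> is_cokernel f k.
Proof.
move=> ef ker; have [W [h cok]] := epi_normal abA ef.
apply: cokernelP => //; first by case: ker.
move=> T t tk; apply: (cokernel_desc cok).
have [u <-] := kernel_lift ker (proj1 cok).
by rewrite comp_assoc tk comp0m.
Qed.

(* The pullback of an epimorphism is an epimorphism; this allows arguing with
   generalized elements, up to precomposition with an epimorphism. *)
Lemma epi_lift X Z T (f : mor X Z) (t : mor T Z) : epi f ->
  exists T' (e : mor T' T) (s : mor T' X), epi e /\ f \oc s = t \oc e.
Proof.
move=> ef; have [S [i1 [i2 [p1 [p2 [pi1 pi2 pi12 pi21 sum]]]]]] :=
  has_biproducts abA X T.
pose d := f \oc p1 - t \oc p2.
have di1 : d \oc i1 = f.
  by rewrite compBm -!comp_assoc pi1 pi21 comp_idr compm0 subr0.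
have ed : epi d by apply: (@epi_compl _ _ _ _ d i1); rewrite di1.
have [P [k ker]] := has_kernels abA d.
have cok := epi_cokernel ed ker.
exists P, (p2 \oc k), (p1 \oc k); split; last first.
  apply/eqP; rewrite -subr_eq0 !comp_assoc -compBm; apply/eqP.
  by case: ker.
(* [d] is the cokernel of its kernel [k], the pullback, so [u \oc p2] factors through [d] as [v];
   restricting to the summand [X] gives [v \oc f = 0]. *)
apply: epi0P => U u; rewrite comp_assoc => /(cokernel_desc cok) [v vd].
have v0 : v = 0.
  by apply: (epi0 ef); rewrite -di1 comp_assoc vd -comp_assoc pi21 compm0.
by rewrite -(comp_idr u) -pi2 comp_assoc -vd v0 !comp0m.
Qed.

(** An element killed by [m] lifts along [q] to an element of the kernel [k], and [q] kills that. *)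
Lemma coimage_mono K X Q Y (k : mor K X) (q : mor X Q) (m : mor Q Y) :
  is_kernel k (m \oc q) -> is_cokernel q k -> mono m.
Proof.
move=> ker cok; apply: mono0P => T t mt.
have [T' [e [s [ee qs]]]] := epi_lift t (cokernel_epi cok).
have [|u ku] := kernel_lift (t := s) ker.
  by rewrite -comp_assoc qs comp_assoc mt comp0m.
by apply: (epi0 ee); rewrite -qs -ku comp_assoc (proj1 cok) comp0m.
Qed.

Lemma exact_lift X Y Z (f : mor X Y) (g : mor Y Z) T (t : mor T Y) :
  exact_at f g -> g \oc t = 0 ->
  exists T' (e : mor T' T) (s : mor T' X), epi e /\ f \oc s = t \oc e.
Proof.
move=> [K [k [e [ker ee fE]]]] gt0; have [u <-] := kernel_lift ker gt0.
have [T' [e' [s [ee' es]]]] := epi_lift u ee.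
by exists T', e', s; split=> //; rewrite fE -!comp_assoc es.
Qed.

Lemma short_exactP L M N (f : mor L M) (g : mor M N) :
  short_exact f g <-> ses f g.
Proof.
split=> [[mf [K [k [e [ker ee fE]]]] eg]|[ker cok]].
  have ker' : is_kernel f g.
    rewrite fE; apply: kernel_iso ker; apply: mono_epi_iso => //.
    by apply: (@mono_compr _ _ _ _ k); rewrite -fE.
  by split=> //; apply: epi_cokernel.
split; [exact: kernel_mono ker | | exact: cokernel_epi cok].
exists L, f, (idm L); split=> //; last by rewrite comp_idr.
exact/iso_epi/is_iso_id.
Qed.

Lemma exact_compm0 X Y Z (f : mor X Y) (g : mor Y Z) :
  exact_at f g -> g \oc f = 0.
Proof.
by move=> [K [k [e [[gk _] _ ->]]]]; rewrite comp_assoc gk comp0m.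
Qed.

(** [exact_at] is not literally self-dual: its dual asks that [g] be a cokernel of [f] followed by a
    monomorphism. That monomorphism is the factor of [g] through its coimage. *)
Lemma exact_op X Y Z (f : mor X Y) (g : mor Y Z) :
  exact_at f g -> exact_at (A := op A) (g : @mor (op A) Z Y) f.
Proof.
move=> [K [k [e [ker ee fE]]]]; have [Q [q cok]] := has_cokernels abA k.
have [m mq] := cokernel_desc cok (proj1 ker).
have cok' : is_cokernel q f.
  apply: cokernelP (cokernel_epi cok) _.
    by rewrite fE comp_assoc (proj1 cok) comp0m.
  move=> T t; rewrite fE comp_assoc => /(epi0 ee); exact: cokernel_desc.
have mm : mono m by apply: (@coimage_mono K _ _ _ k q) => //; rewrite mq.
by exists Q, q, m; split.
Qed.

End Abelian.

Section AbelianDual.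
Variable A : preadditive.
Hypothesis abA : abelian_cat A.
Implicit Types K L M N Q T X Y Z : A.

Lemma op_exact X Y Z (f : mor X Y) (g : mor Y Z) :
  exact_at (A := op A) (g : @mor (op A) Z Y) f -> exact_at f g.
Proof. exact: (exact_op (op_abelian abA)). Qed.

Lemma mono_kernel X Y Q (f : mor X Y) (q : mor Y Q) :
  mono f -> is_cokernel q f -> is_kernel f q.
Proof. exact: (epi_cokernel (op_abelian abA)). Qed.

Lemma image_epi X K Y Q (q : mor Y Q) (k : mor K Y) (e : mor X K) :
  is_cokernel q (k \oc e) -> is_kernel k q -> epi e.
Proof. exact: (coimage_mono (op_abelian abA)). Qed.

Lemma cokernel_exact X Y Z (f : mor X Y) (g : mor Y Z) :
  is_cokernel g f -> exact_at f g.
Proof.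
move=> cok; have [K [k ker]] := has_kernels abA g.
have [e eE] := kernel_lift ker (proj1 cok); exists K, k, e; split=> //.
by apply: (@image_epi _ _ _ _ g k) => //; rewrite eE.
Qed.

Lemma epi_test X Y (f : mor X Y) T (t : mor T Y) (s : mor T X) :
  epi t -> f \oc s = t -> epi f.
Proof. by move=> et fs; apply: (@epi_compl _ _ _ _ f s); rewrite fs. Qed.

Lemma epi_ses M N (g : mor M N) :
  epi g -> exists L (f : mor L M), ses f g.
Proof.
move=> eg; have [L [f ker]] := has_kernels abA g.
by exists L, f; split=> //; apply: epi_cokernel.
Qed.

Lemma mono_ses L M (f : mor L M) :
  mono f -> exists N (g : mor M N), ses f g.
Proof.
move=> mf; have [N [g cok]] := has_cokernels abA f.
by exists N, g; split=> //; apply: mono_kernel.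
Qed.

End AbelianDual.

Lemma ses_comp0 (A : preadditive) (L M N : A) (f : mor L M) (g : mor M N) :
  ses f g -> g \oc f = 0.
Proof. by move=> [[]]. Qed.

Lemma op_ses (A : preadditive) (L M N : A) (f : mor L M) (g : mor M N) :
  ses f g <-> ses (A := op A) (g : @mor (op A) N M) f.
Proof. by split=> -[? ?]; split. Qed.

Lemma op_short_exact (A : preadditive) (abA : abelian_cat A) (L M N : A)
    (f : mor L M) (g : mor M N) :
  short_exact (A := op A) (g : @mor (op A) N M) f <-> short_exact f g.
Proof.
split=> [/(short_exactP (op_abelian abA))|/(short_exactP abA)] /op_ses s.
  exact/(short_exactP abA).
exact/(short_exactP (op_abelian abA)).
Qed.

(** * Retracts, and adjunctions restricted to them *)

Definition retract (A : preadditive) (X Y : A) :=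
  exists (i : mor X Y) (p : mor Y X), p \oc i = idm X.

Lemma retract_fmap (A B : preadditive) (F : functor A B) (X Y : A) :
  retract X Y -> retract (F X) (F Y).
Proof.
by move=> [i [p pi]]; exists (fmap F i), (fmap F p); rewrite -fmap_comp pi fmap1.
Qed.

Lemma retract_trans (A : preadditive) (X Y Z : A) :
  retract X Y -> retract Y Z -> retract X Z.
Proof.
move=> [i [p pi]] [j [q qj]]; exists (j \oc i), (p \oc q).
by rewrite comp_assoc (compm_eq _ qj) comp_idr.
Qed.

Lemma iso_retract (A : preadditive) (X Y : A) (f : mor X Y) :
  is_iso f -> retract X Y.
Proof. by move=> [g [gf _]]; exists f, g. Qed.

Lemma iso_retract_sym (A : preadditive) (X Y : A) (f : mor X Y) :
  is_iso f -> retract Y X.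
Proof. by move=> [g [_ fg]]; exists g, f. Qed.

Lemma fmap_iso (A B : preadditive) (F : functor A B) (X Y : A) (f : mor X Y) :
  is_iso f -> is_iso (fmap F f).
Proof.
by move=> [g [gf fg]]; exists (fmap F g); rewrite -!fmap_comp gf fg !fmap1.
Qed.

Lemma retract_summand (A : preadditive) (abA : abelian_cat A) (X Y : A) :
  retract X Y -> direct_summand X Y.
Proof.
move=> [i [p pi]]; have [K [k ker]] := has_kernels abA p.
have [|q kq] := kernel_lift (t := idm Y - i \oc p) ker.
  by rewrite compmB comp_idr comp_assoc pi comp_idl subrr.
exists K, i, k, p, q; split=> //.
- apply: (kernel_mono ker).
  by rewrite comp_assoc kq compBm -comp_assoc (proj1 ker) compm0 subr0
    comp_idr comp_idl.
- by case: ker.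
- apply: (kernel_mono ker); rewrite comp_assoc kq compBm -comp_assoc pi.
  by rewrite comp_idr comp_idl subrr compm0.
- by rewrite kq addrCA subrr addr0.
Qed.

Section Adjunction.
Variables (A B : preadditive) (L : functor A B) (R : functor B A).
Variable a : adjunction L R.

Lemma right_adjoint_mono (X Y : B) (f : mor X Y) : mono f -> mono (fmap R f).
Proof.
move=> mf T u v fuv.
have tr (w : mor T (R X)) :
    w = fmap R (adj_counit a X \oc fmap L w) \oc adj_unit a T.
  rewrite fmap_comp -comp_assoc -adj_unit_natural comp_assoc triangle_right.
  by rewrite comp_idl.
rewrite (tr u) (tr v); congr (fmap R _ \oc _).
apply: mf; rewrite !comp_assoc !adj_counit_natural -!comp_assoc -!fmap_comp.
by rewrite fuv.
Qed.

Lemma right_adjoint_kernel (K X Y : B) (k : mor K X) (f : mor X Y) :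
  is_kernel k f -> is_kernel (fmap R k) (fmap R f).
Proof.
move=> ker; apply: kernelP.
- by rewrite -fmap_comp (proj1 ker) raddf0.
- exact/right_adjoint_mono/kernel_mono/ker.
move=> T t ft; have [|u ku] := kernel_lift (t := adj_counit a X \oc fmap L t) ker.
  rewrite comp_assoc adj_counit_natural -comp_assoc -fmap_comp ft raddf0.
  exact: compm0.
exists (fmap R u \oc adj_unit a T).
rewrite comp_assoc -fmap_comp ku fmap_comp -comp_assoc -adj_unit_natural.
by rewrite comp_assoc triangle_right comp_idl.
Qed.

Lemma unit_iso_retract (X Y : A) :
  retract X Y -> is_iso (adj_unit a Y) -> is_iso (adj_unit a X).
Proof.
move=> [i [p pi]] [e [eu ue]].
apply: (@isoP_lr _ _ _ _ (p \oc e \oc fmap R (fmap L i))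
                         (p \oc e \oc fmap R (fmap L i))).
  rewrite -comp_assoc -adj_unit_natural comp_assoc (compm_eq _ eu) comp_idr.
  exact: pi.
rewrite !comp_assoc adj_unit_natural (compm_eq _ ue) comp_idr -!fmap_comp pi.
by rewrite !fmap1.
Qed.

End Adjunction.

Section LeftAdjoint.
Variables (A B : preadditive) (L : functor A B) (R : functor B A).
Variable a : adjunction L R.

Lemma left_adjoint_epi (X Y : A) (f : mor X Y) : epi f -> epi (fmap L f).
Proof. exact: (right_adjoint_mono (op_adjunction a)). Qed.

Lemma left_adjoint_cokernel (X Y Q : A) (q : mor Y Q) (f : mor X Y) :
  is_cokernel q f -> is_cokernel (fmap L q) (fmap L f).
Proof. exact: (right_adjoint_kernel (op_adjunction a)). Qed.

Lemma counit_iso_retract (X Y : B) :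
  retract X Y -> is_iso (adj_counit a Y) -> is_iso (adj_counit a X).
Proof.
move=> [i [p pi]] /(op_iso (A:=B)) c; apply/(op_iso (A:=B)).
by apply: (unit_iso_retract (a := op_adjunction a)) c; exists p, i.
Qed.

(** By a triangle identity [R] sends the counit to a split epimorphism, and a faithful functor
    reflects epimorphisms. *)
Lemma faithful_counit_epi (Y : B) : faithful R -> epi (adj_counit a Y).
Proof.
move=> fR T u v /(congr1 (fmap R)) uv; apply: fR; move: uv; rewrite !fmap_comp.
move=> /(congr1 (fun w => w \oc adj_unit a (R Y))).
by rewrite -!comp_assoc triangle_right !comp_idr.
Qed.

End LeftAdjoint.

Lemma faithful_unit_mono (A B : preadditive) (L : functor A B)
    (R : functor B A) (a : adjunction L R) (X : A) :
  faithful L -> mono (adj_unit a X).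
Proof.
move=> fL; apply: (faithful_counit_epi (a := op_adjunction a)).
by move=> Y Z u v; apply: fL.
Qed.

(** * Right minimal morphisms in Krull-Schmidt categories *)

Section KrullSchmidt.
Variable A : preadditive.
Implicit Types X Y Z M N T : A.

(** Jacobson's lemma: if [u] inverts [1 - s r], then [1 + r u s] inverts [1 - r s]. *)
Lemma id_sub_comp_iso X Y (s : mor Y X) (r : mor X Y) :
  is_iso (idm X - s \oc r) -> is_iso (idm Y - r \oc s).
Proof.
move=> [u [u1 u2]]; exists (idm Y + r \oc u \oc s); split.
- have -> : (idm Y + r \oc u \oc s) \oc (idm Y - r \oc s) =
    idm Y - r \oc s + r \oc (u \oc (idm X - s \oc r)) \oc s.
    rewrite comp_addl comp_idl; congr (_ + _).
    by rewrite !compmB !comp_idr !compBm !comp_assoc.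
  by rewrite u1 comp_idr addrNK.
- have -> : (idm Y - r \oc s) \oc (idm Y + r \oc u \oc s) =
    idm Y - r \oc s + r \oc ((idm X - s \oc r) \oc u) \oc s.
    rewrite comp_addr comp_idr; congr (_ + _).
    by rewrite !compBm !comp_idl !compmB !compBm !comp_assoc.
  by rewrite u2 comp_idr addrNK.
Qed.

(** The Jacobson radical of the category; [id_sub_comp_iso] makes this one-sided condition a
    two-sided ideal. *)
Definition in_radical X Y (r : mor X Y) :=
  forall s : mor Y X, is_iso (idm X - s \oc r).

Lemma in_radical0 X Y : in_radical (0 : mor X Y).
Proof. by move=> s; rewrite compm0 subr0; apply: is_iso_id. Qed.

Lemma in_radicalD X Y (r r' : mor X Y) :
  in_radical r -> in_radical r' -> in_radical (r + r').
Proof.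
move=> rr rr' s; have isr := rr s; have [v [vu uv]] := isr.
have -> : idm X - s \oc (r + r') = (idm X - s \oc r) \oc (idm X - v \oc s \oc r').
  rewrite compmB comp_idr -comp_assoc comp_assoc uv comp_idl comp_addr opprD.
  by rewrite addrA.
by apply: iso_comp.
Qed.

Lemma in_radical_comp X Y Z T (t : mor Y Z) (r : mor X Y) (u : mor T X) :
  in_radical r -> in_radical (t \oc r \oc u).
Proof.
move=> rr s; have := @id_sub_comp_iso X T u (s \oc t \oc r).
rewrite !comp_assoc; apply; exact: (rr (u \oc s \oc t)).
Qed.

Lemma in_radical_sum X Y I (s : seq I) (r : I -> mor X Y) :
  (forall i, in_radical (r i)) -> in_radical (\sum_(i <- s) r i).
Proof.
move=> rr; elim: s => [|i s IH]; first by rewrite big_nil; apply: in_radical0.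
by rewrite big_cons; apply: in_radicalD.
Qed.

Lemma local_split X (e : mor X X) :
  local_end X -> is_iso e \/ is_iso (idm X - e).
Proof.
move=> [_ loc]; case: (classic (is_iso e)) => [|ne]; first by left.
right; apply: NNPP => ne'; apply: (loc _ _ ne ne').
by rewrite addrC addrNK; apply: is_iso_id.
Qed.

(** If [1 - s r] is not invertible, then [s r] is, with inverse [w], and [r w s] is an idempotent of
    the local ring End([Y]). Either it is invertible, making [r] an isomorphism, or its complement
    is, forcing [r = 0] against [idm X <> 0]. *)
Lemma local_in_radical X Y (r : mor X Y) :
  local_end X -> local_end Y -> ~ is_iso r -> in_radical r.
Proof.
move=> lX lY nr s; case: (local_split (s \oc r) lX) => // -[w [wsr _]].
rewrite comp_assoc in wsr; case: nr.
case: (local_split (r \oc (w \oc s)) lY) => -[v [vi iv]].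
- apply: (@isoP_lr _ _ _ _ (w \oc s) (w \oc s)) => //.
  rewrite -[LHS]comp_idl -vi -comp_assoc; congr (v \oc _).
  by rewrite -(comp_assoc r) (comp_assoc (w \oc s)) wsr comp_idl.
- suff r0 : r = 0 by case: (proj1 lX); rewrite -wsr r0 compm0.
  rewrite -(comp_idl r) -vi -comp_assoc compBm comp_idl.
  by rewrite -(comp_assoc r) wsr comp_idr subrr compm0.
Qed.

Definition right_minimal M N (g : mor M N) :=
  forall phi : mor M M, g \oc phi = g -> is_iso phi.

(** Otherwise all components of [psi] lie in the radical, hence so does [psi], and [1 - psi] would
    be invertible. *)
Lemma local_sum_component_iso (n : nat) (X : 'I_n -> A) M
    (i : forall j, mor (X j) M) (p : forall j, mor M (X j)) (psi : mor M M) :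
  (forall j, local_end (X j)) -> \sum_j (i j \oc p j) = idm M ->
  ~ is_iso (idm M - psi) -> exists j k, is_iso (p j \oc psi \oc i k).
Proof.
move=> loc sum nphi; apply: NNPP => no; apply: nphi.
rewrite -(comp_idl psi); suff : in_radical psi by apply.
rewrite -(comp_idl psi) -(comp_idr (_ \oc psi)) -{1}sum -sum.
rewrite comp_suml comp_suml; apply: in_radical_sum => j.
rewrite comp_sumr; apply: in_radical_sum => k.
have -> : i j \oc p j \oc psi \oc (i k \oc p k) =
  i j \oc (p j \oc psi \oc i k) \oc p k by rewrite !comp_assoc.
apply: in_radical_comp; apply: local_in_radical => // iso.
by apply: no; exists j, k.
Qed.

Hypothesis abA : abelian_cat A.

(** Induction on the number of local summands of [M]: as long as [g] is not right minimal, a local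
    summand on which it vanishes can be split off. *)
Lemma right_minimal_part M N (g : mor M N) : krull_schmidt A ->
  exists (M1 T : A) (i1 : mor M1 M) (i2 : mor T M) (p1 : mor M M1)
    (p2 : mor M T),
    [/\ is_biproduct i1 i2 p1 p2, g \oc i2 = 0 & right_minimal (g \oc i1)].
Proof.
move=> ks; have [n [X [[i [p [pi pi0 sum]]] loc]]] := ks M.
elim: n M g X i p pi pi0 sum loc => [|n IH] M g X i p pi pi0 sum loc.
all: case: (classic (right_minimal g)) => [ming|nming].
1,3: have [Z [Z0 Z1]] := has_zero abA;
  exists M, Z, (idm M), 0, (idm M), 0; rewrite compm0 comp_idr; split=> //;
  by split; rewrite ?comp_idl ?comp0m ?compm0 ?addr0 //; apply/esym/Z0.
all: have [phi [gphi nphi]] : exists phi, g \oc phi = g /\ ~ is_iso phi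
  by apply: NNPP => no; apply: nming => phi gphi; apply: NNPP => nphi;
     apply: no; exists phi.
all: have [|j [k isok]] := local_sum_component_iso (psi := idm M - phi) loc sum;
  first by rewrite opprB addrCA subrr addr0.
  (* In the base case the index [j] would lie in ['I_0]. *)
  by case: (j).
pose psi := idm M - phi; have gpsi : g \oc psi = 0.
  by rewrite compmB comp_idr gphi subrr.
have [v [vk kv]] := isok.
(* The summand X j of M, embedded through psi, is killed by g; the kernel of
   the projection p j is a complement. *)
pose ij := psi \oc i k \oc v.
have pij : p j \oc ij = idm (X j) by rewrite !comp_assoc kv.
have gij : g \oc ij = 0 by rewrite !comp_assoc gpsi !comp0m.
clearbody ij.
have [K [kap ker]] := has_kernels abA (p j).
have mk := kernel_mono ker.
have [|pk kpk] := kernel_lift (t := idm M - ij \oc p j) ker.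
  by rewrite compmB comp_idr comp_assoc pij comp_idl subrr.
have pkk : pk \oc kap = idm K.
  apply: mk; rewrite comp_assoc kpk compBm -comp_assoc (proj1 ker) compm0.
  by rewrite subr0 comp_idr comp_idl.
have pkij : pk \oc ij = 0.
  apply: mk; rewrite comp_assoc kpk compBm -comp_assoc pij comp_idr.
  by rewrite comp_idl subrr compm0.
have lift_i l : {w : mor (X (lift j l)) K | kap \oc w = i (lift j l)}.
  apply: constructive_indefinite_description; apply: (kernel_lift ker).
  by apply: pi0; apply: neq_lift.
pose ii l := sval (lift_i l).
have kii l : kap \oc ii l = i (lift j l) := svalP (lift_i l).
(* The complement [K] of the new summand is decomposed by the remaining [X (lift j l)], so the
   induction hypothesis applies to [g] restricted to [K]. *)
have [||||M1 [T [i1 [i2 [p1 [p2 [bip gi2 min1]]]]]]] :=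
  IH K (g \oc kap) (fun l => X (lift j l)) ii (fun l => p (lift j l) \oc kap).
- by move=> l; rewrite -comp_assoc kii pi.
- move=> l l' ll'; rewrite -comp_assoc kii pi0 //.
  by rewrite (inj_eq lift_inj).
- apply: mk; rewrite comp_sumr comp_idr.
  under eq_bigr => l _ do rewrite !comp_assoc kii.
  rewrite -[RHS]comp_idl -sum comp_suml (bigD1_ord j) //=.
  by rewrite -(comp_assoc (i j)) (proj1 ker) compm0 add0r.
- by move=> l; apply: loc.
case: bip => b1 b2 b3 b4 b5.
(* The part killed by [g] is the one found inside [K] enlarged by [X j]. *)
have [S [j1 [j2 [q1 [q2 [c1 c2 c3 c4 c5]]]]]] := has_biproducts abA (X j) T.
exists M1, S, (kap \oc i1), (ij \oc q1 + kap \oc i2 \oc q2), (p1 \oc pk),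
  (j1 \oc p j + j2 \oc p2 \oc pk); split; last by rewrite comp_assoc.
- split.
  + by rewrite comp_assoc (compm_eq _ pkk) comp_idr.
  + rewrite comp_addl !comp_addr !comp_assoc.
    rewrite (compm_eq _ pij) (compm_eq _ (proj1 ker)) (compm_eq _ pkij).
    rewrite (compm_eq _ pkk) !compm0 !comp0m !comp_idr.
    by rewrite (compm_eq _ b2) comp_idr addr0 add0r.
  + rewrite comp_addr !comp_assoc (compm_eq _ pkij) (compm_eq _ pkk).
    by rewrite compm0 comp0m comp_idr b3 comp0m addr0.
  + rewrite comp_addl !comp_assoc (compm_eq _ pkk) (compm_eq _ (proj1 ker)).
    by rewrite compm0 comp0m comp_idr (compm_eq _ b4) compm0 addr0.
  + rewrite comp_addl !comp_addr !comp_assoc.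
    rewrite (compm_eq _ c1) (compm_eq _ c2) (compm_eq _ c3) (compm_eq _ c4).
    rewrite !compm0 !comp0m !comp_idr addr0 add0r addrCA.
    have -> : kap \oc i1 \oc p1 \oc pk + kap \oc i2 \oc p2 \oc pk =
      kap \oc (i1 \oc p1 + i2 \oc p2) \oc pk.
      by rewrite comp_addr comp_addl !comp_assoc.
    by rewrite b5 comp_idr kpk addrCA subrr addr0.
- by rewrite comp_addr !comp_assoc gij comp0m add0r gi2 comp0m.
Qed.

End KrullSchmidt.

(** * Almost split sequences in extension-closed subcategories *)

Section AlmostSplit.
Variable A : preadditive.
Hypothesis abA : abelian_cat A.
Implicit Types K L M N B T : A.

Lemma pushout L M N (f : mor L M) (g : mor M N) B (h : mor L B) :
  ses f g -> exists E (b : mor B E) (e : mor E N) (w : mor M E),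
    [/\ ses b e, w \oc f = b \oc h & e \oc w = g].
Proof.
move=> [ker cok].
have [S [i1 [i2 [p1 [p2 [pi1 pi2 pi12 pi21 sum]]]]]] := has_biproducts abA M B.
(* The cokernel of [d] is the pushout of [f] and [h]; [d] is a monomorphism because its first
   component [f] is. *)
pose d := i1 \oc f - i2 \oc h.
have [E [q cq]] := has_cokernels abA d.
have p1d : p1 \oc d = f.
  by rewrite compmB !comp_assoc pi1 pi12 comp0m comp_idl subr0.
have [|e eq] := cokernel_desc (t := g \oc p1) cq.
  by rewrite -comp_assoc p1d; case: ker.
have kd : is_kernel d q.
  apply: mono_kernel cq => //; apply: (@mono_compr _ _ _ _ p1).
  by rewrite p1d; apply: kernel_mono ker.
have eqi : e \oc (q \oc i1) = g.
  by rewrite comp_assoc eq -comp_assoc pi1 comp_idr.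
have qeq : q \oc i1 \oc f = q \oc i2 \oc h.
  apply/eqP; rewrite -subr_eq0 -!comp_assoc -compmB; apply/eqP.
  by case: cq.
have mb : mono (q \oc i2).
  apply: mono0P => T t; rewrite -comp_assoc => /(kernel_lift kd) [u du].
  have u0 : u = 0.
    apply: (mono0 (kernel_mono ker)); rewrite -p1d -comp_assoc du comp_assoc.
    by rewrite pi12 comp0m.
  by rewrite -(comp_idl t) -pi2 -comp_assoc -du u0 !compm0.
have cb : is_cokernel e (q \oc i2).
  apply: cokernelP.
  - by rewrite comp_assoc eq -comp_assoc pi12 compm0.
  - apply: (@epi_compl _ _ _ _ e (q \oc i1)); rewrite eqi.
    exact: cokernel_epi cok.
  move=> T t tb; have [|v vg] := cokernel_desc (t := t \oc (q \oc i1)) cok.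
    by rewrite -comp_assoc qeq comp_assoc tb comp0m.
  exists v; apply: (cokernel_epi cq).
  rewrite -comp_assoc eq comp_assoc vg -[RHS]comp_idr -sum comp_addr.
  rewrite !comp_assoc in tb *.
  by rewrite tb comp0m addr0.
exists E, (q \oc i2), e, (q \oc i1); split=> //.
by split=> //; apply: mono_kernel.
Qed.

Lemma ses_split L M N (f : mor L M) (g : mor M N) :
  ses f g -> split_epi g <-> split_mono f.
Proof.
move=> [ker cok]; split=> [[s gs]|[r rf]].
- have [|r fr] := kernel_lift (t := idm M - s \oc g) ker.
    by rewrite compmB comp_assoc gs comp_idr comp_idl subrr.
  exists r; apply: (kernel_mono ker).
  by rewrite comp_assoc fr compBm -comp_assoc (proj1 ker) compm0 subr0
    comp_idl comp_idr.
- have [|s sg] := cokernel_desc (t := idm M - f \oc r) cok.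
    by rewrite compBm -comp_assoc rf comp_idr comp_idl subrr.
  exists s; apply: (cokernel_epi cok).
  by rewrite -comp_assoc sg compmB comp_assoc (proj1 ker) comp0m subr0
    comp_idl comp_idr.
Qed.

Variable P : A -> Prop.
Hypothesis P_extension : forall L M N (f : mor L M) (g : mor M N),
  ses f g -> P L -> P N -> P M.
Hypothesis P_retract : forall M N, retract M N -> P N -> P M.

(* If the pushout M -> E -> N of the sequence along h : L -> B does not split,
   then E -> N factors through g, and M -> E -> M is invertible by minimality,
   so that h is a split monomorphism. *)
Lemma right_minimal_left_almost_split L M N (f : mor L M) (g : mor M N) :
  ses f g -> P N -> right_almost_split P g -> right_minimal g ->
  left_almost_split P f.
Proof.
move=> fg PN [nse ras] min; split; first by move/(ses_split fg).
move=> B h PB nsh; have [E [b [e [w [be wf ew]]]]] := pushout h fg.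
(* If the pushout splits, its retraction composed with [w] extends [h] along [f]. *)
case: (classic (split_epi e)) => [/(ses_split be) [r rb]|ne].
  by exists (r \oc w); rewrite -comp_assoc wf comp_assoc rb comp_idl.
have [u gu] := ras _ _ (P_extension be PB PN) ne.
have guw : g \oc (u \oc w) = g by rewrite comp_assoc gu.
have [phi [p1 p2]] := min _ guw.
case: nsh; have [|x fx] := kernel_lift (t := phi \oc u \oc b) (proj1 fg).
  have gphi : g \oc phi = g by rewrite -{1}guw -comp_assoc p2 comp_idr.
  by rewrite !comp_assoc gphi gu (ses_comp0 be).
exists x; apply: (kernel_mono (proj1 fg)).
rewrite comp_assoc fx -comp_assoc -wf comp_assoc -(comp_assoc phi) p1.
by rewrite comp_idl comp_idr.
Qed.

(** Write [M] as [M1] plus [T] with [g] right minimal on [M1] and zero on [T]. Then [T] embeds in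
    [L], with complement the kernel [L1] of [g] on [M1]: the [T] parts form the trivial sequence,
    and the rest is almost split by minimality. *)
Lemma almost_split_plus_leftP L M N (f : mor L M) (g : mor M N) :
  krull_schmidt A -> ses f g -> P L -> P N -> right_almost_split P g ->
  almost_split_plus_left P f g.
Proof.
move=> ks fg PL PN rasg; have PM := P_extension fg PL PN.
have [M1 [T [i1 [i2 [p1 [p2 [bip gi2 min]]]]]]] := right_minimal_part abA g ks.
case: (bip) => b1 b2 b3 b4 b5; have [nse ras] := rasg.
have g1p1 : g \oc i1 \oc p1 = g.
  by rewrite -[RHS]comp_idr -b5 comp_addr !comp_assoc gi2 comp0m addr0.
have [ker cok] := fg; have mf := kernel_mono ker.
have eg1 : epi (g \oc i1).
  by apply: (@epi_compl _ _ _ _ _ p1); rewrite g1p1; apply: cokernel_epi cok.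
have [L1 [f1 f1g1]] := epi_ses abA eg1; have [ker1 _] := f1g1.
have mf1 := kernel_mono ker1.
have [|j1 fj1] := kernel_lift (t := i1 \oc f1) ker.
  by rewrite comp_assoc; case: ker1.
have [j2 fj2] := kernel_lift ker gi2.
have [|q1 f1q1] := kernel_lift (t := p1 \oc f) ker1.
  by rewrite comp_assoc g1p1; case: ker.
have q1j1 : q1 \oc j1 = idm L1.
  apply: mf1; rewrite comp_assoc f1q1 -comp_assoc fj1 comp_assoc b1.
  by rewrite comp_idl comp_idr.
have q2j2 : p2 \oc f \oc j2 = idm T by rewrite -comp_assoc fj2.
have bipL : is_biproduct j1 j2 q1 (p2 \oc f).
  split=> //.
  - by apply: mf1; rewrite comp_assoc f1q1 -comp_assoc fj2 b3 compm0.
  - by rewrite -comp_assoc fj1 comp_assoc b4 comp0m.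
  - apply: mf; rewrite comp_addr !comp_assoc fj1 fj2 -(comp_assoc i1) f1q1.
    by rewrite comp_assoc -comp_addl b5 comp_idl comp_idr.
have PL1 : P L1 by apply: P_retract PL; exists j1, q1.
have PM1 : P M1 by apply: P_retract PM; exists i1, p1.
have PT : P T by apply: P_retract PM; exists i2, p2.
have ras1 : right_almost_split P (g \oc i1).
  split=> [[s gs]|B h PB nh].
    by apply: nse; exists (i1 \oc s); rewrite comp_assoc.
  have [u gu] := ras B h PB nh; exists (p1 \oc u).
  by rewrite comp_assoc g1p1.
have [Z Z0] := has_zero abA.
exists L1, M1, N, f1, (g \oc i1), T, Z; split=> //.
  split=> //; last exact: right_minimal_left_almost_split f1g1 PN ras1 min.
  by split=> //; apply/(short_exactP abA).
exists j1, j2, q1, (p2 \oc f), i1, i2, p1, p2, (idm N), 0, (idm N), 0.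
have [ZX ZY] := Z0.
split=> //; last by rewrite comp_idl comp0m.
- by split; rewrite ?comp0m ?compm0 ?comp_idl ?addr0 //; apply/esym/ZX.
- by rewrite fj1 fj2 comp_idr.
Qed.

End AlmostSplit.

(** * Gorenstein projective and injective objects in dimension at most 1 *)

Section Relative.
Variable A : preadditive.
Implicit Types K L M N P Q X Y Z : A.

Definition sub_of (R : A -> Prop) X := exists P (m : mor X P), R P /\ mono m.

Definition quot_of (R : A -> Prop) X := exists P (q : mor P X), R P /\ epi q.

Lemma sub_of_mono R X Y (f : mor X Y) : mono f -> sub_of R Y -> sub_of R X.
Proof.
by move=> mf [P [m [RP mm]]]; exists P, (m \oc f); split=> //; apply: mono_comp.
Qed.

Lemma sub_of_retract R X Y : retract X Y -> sub_of R Y -> sub_of R X.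
Proof.
move=> [i [p pi]]; apply: (@sub_of_mono _ _ _ i); apply: (@mono_compr _ _ _ _ p).
by rewrite pi; apply/iso_mono/is_iso_id.
Qed.

Variables (nu num : functor A A) (a : adjunction nu num).

(* The properties of the relative projectives RP and the relative injectives RI
   of an Iwanaga-Gorenstein adjunction of dimension at most 1; they are
   exchanged by passing to the opposite category. The last two express the
   vanishing of L_1 nu on subobjects of relative projectives, and dually. *)
Record gorenstein_setting (RP RI : A -> Prop) : Prop := GorensteinSetting {
  gs_cover : forall X, exists P (p : mor P X), RP P /\ epi p;
  gs_envelope : forall X, exists I (m : mor X I), RI I /\ mono m;
  gs_nu : forall P, RP P -> RI (nu P);
  gs_num : forall I, RI I -> RP (num I);
  gs_unit : forall P, RP P -> is_iso (adj_unit a P);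
  gs_counit : forall I, RI I -> is_iso (adj_counit a I);
  gs_nu_mono : forall K P X Q (i : mor K P) (p : mor P X) (m : mor X Q),
    RP P -> RP Q -> ses i p -> mono m -> mono (fmap nu i);
  gs_num_epi : forall K P X Q (i : mor P K) (p : mor X P) (m : mor Q X),
    RI P -> RI Q -> ses p i -> epi m -> epi (fmap num i)
}.

End Relative.

Lemma op_gorenstein_setting (A : preadditive) (nu num : functor A A)
    (a : adjunction nu num) (RP RI : A -> Prop) :
  gorenstein_setting a RP RI ->
  gorenstein_setting (A := op A) (op_adjunction a) RI RP.
Proof.
case=> cov env nuP numI un cou num_ nue; split=> //.
- by move=> P /cou /op_iso.
- by move=> P /un /op_iso.
- move=> K P X Q i p m rP rQ /op_ses s; exact: (nue K P X Q i p m rP rQ s).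
- move=> K P X Q i p m rP rQ /op_ses s; exact: (num_ K P X Q i p m rP rQ s).
Qed.

Section GorensteinProjectives.
Variable A : preadditive.
Hypothesis abA : abelian_cat A.
Variables (nu num : functor A A) (a : adjunction nu num) (RP RI : A -> Prop).
Hypothesis gs : gorenstein_setting a RP RI.
Implicit Types K L M N P Q X Y Z : A.

(** With [P] covering [M] and [K] the kernel of [P -> N], [L] is the quotient of [K] by the kernel
    [KM] of [p]. An element of [nu L] killed by [nu f] lifts to [nu K]; its image in [nu P] comes
    from [nu KM], and since [nu k] is mono the lift itself comes from [nu KM], so it dies in
    [nu L]. *)
Lemma nu_ses L M N (f : mor L M) (g : mor M N) :
  ses f g -> sub_of RP N -> ses (fmap nu f) (fmap nu g).
Proof.
move=> fg [P0 [m [RP0 mm]]]; have [ker cok] := fg; have mf := kernel_mono ker.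
suff mnf : mono (fmap nu f).
  have cok' := left_adjoint_cokernel a cok.
  by split=> //; apply: mono_kernel.
have [P [p [RPP ep]]] := gs_cover gs M.
have [KM [km sM]] := epi_ses abA ep.
have [K [k sk]] := epi_ses abA (epi_comp (cokernel_epi cok) ep).
have mnk := gs_nu_mono gs RPP RP0 sk mm.
have [j kj] : exists j, k \oc j = km.
  apply: (kernel_lift (proj1 sk)).
  by rewrite -comp_assoc (ses_comp0 sM) compm0.
have [l fl] : exists l, f \oc l = p \oc k.
  by apply: (kernel_lift ker); rewrite comp_assoc (ses_comp0 sk).
have lj : l \oc j = 0.
  by apply: (mono0 mf); rewrite comp_assoc fl -comp_assoc kj (ses_comp0 sM).
have el : epi l.
  (* Lifting [f] along [p] gives an element of [K] that [l] maps onto [L]. *)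
  have [E [e [s [ee ps]]]] := epi_lift abA f ep.
  have [|s' ks] := kernel_lift (t := s) (proj1 sk).
    by rewrite -comp_assoc ps comp_assoc (proj1 ker) comp0m.
  apply: (epi_test ee (s := s')); apply: mf.
  by rewrite comp_assoc fl -comp_assoc ks.
apply: mono0P => T t nft.
have [T1 [e1 [s1 [ee1 ls1]]]] := epi_lift abA t (left_adjoint_epi a el).
have ex := cokernel_exact abA (left_adjoint_cokernel a (proj2 sM)).
have [|T2 [e2 [s2 [ee2 ks2]]]] := exact_lift abA (t := fmap nu k \oc s1) ex.
  rewrite comp_assoc -fmap_comp -fl fmap_comp -comp_assoc ls1 comp_assoc nft.
  by rewrite comp0m.
apply: (epi0 ee1); apply: (epi0 ee2); rewrite -ls1 -comp_assoc.
have -> : s1 \oc e2 = fmap nu j \oc s2.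
  by apply: mnk; rewrite !comp_assoc -ks2 -fmap_comp kj.
by rewrite comp_assoc -fmap_comp lj raddf0 comp0m.
Qed.

Lemma sub_of_num Y : sub_of RP (num Y).
Proof.
have [I [m [RII mm]]] := gs_envelope gs Y.
exists (num I), (fmap num m); split; first exact: (gs_num gs RII).
exact: (right_adjoint_mono a).
Qed.

End GorensteinProjectives.

Section GorensteinInjectives.
Variable A : preadditive.
Hypothesis abA : abelian_cat A.
Variables (nu num : functor A A) (a : adjunction nu num) (RP RI : A -> Prop).
Hypothesis gs : gorenstein_setting a RP RI.
Implicit Types K L M N P Q X Y Z : A.

Let opgs := op_gorenstein_setting gs.

Lemma num_ses L M N (f : mor L M) (g : mor M N) :
  ses f g -> quot_of RI L -> ses (fmap num f) (fmap num g).
Proof.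
move=> /op_ses s qL; apply/op_ses; exact: (nu_ses (op_abelian abA) opgs s qL).
Qed.

Lemma quot_of_nu Y : quot_of RI (nu Y).
Proof. exact: (sub_of_num opgs Y). Qed.

(* Resolve X by K -> P -> X; both nu and num are exact on it, so the unit at X
   is a cokernel of the (isomorphic) units at P. *)
Lemma unit_iso X : sub_of RP X -> is_iso (adj_unit a X).
Proof.
move=> SX; have [P0 [m [RP0 mm]]] := SX; apply: (mono_epi_iso abA).
  apply: (@mono_compr _ _ _ _ (fmap num (fmap nu m))).
  rewrite -adj_unit_natural; apply: mono_comp mm.
  by apply: iso_mono; apply: (gs_unit gs RP0).
have [P [p [RPP ep]]] := gs_cover gs X.
have [K [k kp]] := epi_ses abA ep.
have [_ cok] := num_ses (nu_ses abA gs kp SX) (quot_of_nu K).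
apply: (@epi_compl _ _ _ _ _ p); rewrite adj_unit_natural.
by apply: epi_comp (cokernel_epi cok) (iso_epi _); apply: (gs_unit gs RPP).
Qed.

End GorensteinInjectives.

Section Extensions.
Variable A : preadditive.
Hypothesis abA : abelian_cat A.
Variables (nu num : functor A A) (a : adjunction nu num) (RP RI : A -> Prop).
Hypothesis gs : gorenstein_setting a RP RI.
Implicit Types K L M N P Q X Y Z : A.

Lemma counit_iso Y : quot_of RI Y -> is_iso (adj_counit a Y).
Proof.
move=> qY; apply/(op_iso (A:=A)).
exact: (unit_iso (op_abelian abA) (op_gorenstein_setting gs) qY).
Qed.

(** Since [num (nu M)] embeds in a relative projective, it suffices that the unit at [M] is mono.
    This is a four-lemma chase from the invertible units at [L] and [N]. *)
Lemma sub_of_extension L M N (f : mor L M) (g : mor M N) :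
  ses f g -> sub_of RP L -> sub_of RP N -> sub_of RP M.
Proof.
move=> fg SL SN; apply: (sub_of_mono (f := adj_unit a M)); last first.
  exact: (sub_of_num gs).
apply: mono0P => T t ht; have [u fu] : exists u, f \oc u = t.
  apply: (kernel_lift (proj1 fg)); apply: (mono0 (iso_mono (unit_iso abA gs SN))).
  by rewrite comp_assoc adj_unit_natural -comp_assoc ht compm0.
suff u0 : u = 0 by rewrite -fu u0 compm0.
apply: (mono0 (iso_mono (unit_iso abA gs SL))).
have [/kernel_mono mf _] := nu_ses abA gs fg SN.
apply: (mono0 (right_adjoint_mono a mf)).
by rewrite comp_assoc -adj_unit_natural -comp_assoc fu.
Qed.

Lemma sub_of_syzygy X : exists Z P (i : mor Z P) (p : mor P X),
  [/\ sub_of RP Z, RP P & ses i p].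
Proof.
have [P [p [RPP ep]]] := gs_cover gs X; have [Z [i s]] := epi_ses abA ep.
exists Z, P, i, p; split=> //; exists P, i; split=> //.
by case: s => /kernel_mono.
Qed.

(** Embed [nu X] in a relative injective and apply [num], which is exact there because [nu X] is a
    quotient of a relative injective; the unit identifies [num (nu X)] with [X]. *)
Lemma sub_of_cosyzygy X : sub_of RP X -> exists Z P (i : mor X P) (p : mor P Z),
  [/\ sub_of RP Z, RP P & ses i p].
Proof.
move=> SX; have [I [m [RII mm]]] := gs_envelope gs (nu X).
have [W [q mq]] := mono_ses abA mm.
have [ker cok] := num_ses abA gs mq (quot_of_nu gs X).
exists (num W), (num I), (fmap num m \oc adj_unit a X), (fmap num q).
split; [exact: (sub_of_num gs) | exact: (gs_num gs RII) |].
have ker' := kernel_iso (unit_iso abA gs SX) ker.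
by split=> //; apply: (epi_cokernel abA) ker'; apply: cokernel_epi cok.
Qed.

End Extensions.

Section QuotExtensions.
Variable A : preadditive.
Hypothesis abA : abelian_cat A.
Variables (nu num : functor A A) (a : adjunction nu num) (RP RI : A -> Prop).
Hypothesis gs : gorenstein_setting a RP RI.
Implicit Types K L M N P Q X Y Z : A.

Let abAop := op_abelian abA.
Let opgs := op_gorenstein_setting gs.

Lemma quot_of_extension L M N (f : mor L M) (g : mor M N) :
  ses f g -> quot_of RI L -> quot_of RI N -> quot_of RI M.
Proof.
move=> /op_ses s qL qN; exact: (sub_of_extension abAop opgs s qN qL).
Qed.

Lemma quot_of_cosyzygy X : exists Z P (i : mor X P) (p : mor P Z),
  [/\ quot_of RI Z, RI P & ses i p].
Proof.
have [Z [P [i [p [qZ RIP /op_ses s]]]]] := sub_of_syzygy abAop opgs X.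
by exists Z, P, p, i.
Qed.

Lemma quot_of_syzygy X : quot_of RI X -> exists Z P (i : mor Z P) (p : mor P X),
  [/\ quot_of RI Z, RI P & ses i p].
Proof.
move=> qX; have [Z [P [i [p [qZ RIP /op_ses s]]]]] :=
  sub_of_cosyzygy abAop opgs qX.
by exists Z, P, p, i.
Qed.

End QuotExtensions.

Lemma quot_of_retract (A : preadditive) (R : A -> Prop) (X Y : A) :
  retract X Y -> quot_of R Y -> quot_of R X.
Proof.
by move=> [i [p pi]]; apply: (@sub_of_retract (op A)); exists p, i.
Qed.

(* The complex is spliced from the sequences Z_{n+1} -> Q_n -> Z_n. *)
Lemma complete_resolution (A : preadditive) (F : functor A A) (S R : A -> Prop) :
  (forall X, S X -> exists Z Q (i : mor Z Q) (p : mor Q X),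
    [/\ S Z, R Q & ses i p]) ->
  (forall X, S X -> exists Z Q (i : mor X Q) (p : mor Q Z),
    [/\ S Z, R Q & ses i p]) ->
  (forall L M N (f : mor L M) (g : mor M N),
    S L -> S N -> ses f g -> ses (fmap F f) (fmap F g)) ->
  forall X, S X -> exists Q : complex A,
    [/\ forall n, R (Q n), exact_complex Q, exact_complex (map_complex F Q)
      & exists k : mor X (Q (-1 + 1)), is_kernel k (cdiff Q (-1))].
Proof.
move=> syz cosyz Fses X SX.
pose step (z' z : {Z | S Z}) := exists Q (i : mor (sval z') Q)
  (p : mor Q (sval z)), R Q /\ ses i p.
have down (z : {Z | S Z}) : {z' | step z' z}.
  apply: constructive_indefinite_description.
  have [Z [Q [i [p [SZ RQ s]]]]] := syz _ (svalP z).
  by exists (exist _ Z SZ), Q, i, p.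
have up (z : {Z | S Z}) : {z' | step z z'}.
  apply: constructive_indefinite_description.
  have [Z [Q [i [p [SZ RQ s]]]]] := cosyz _ (svalP z).
  by exists (exist _ Z SZ), Q, i, p.
pose z0 : {Z | S Z} := exist _ X SX.
(* Nonnegative indices iterate syzygies of [X], negative ones cosyzygies; [Negz m] is [-(m+1)],
   hence [m.+1] steps. *)
pose W (n : int) := match n with
  | Posz m => iter m (fun z => sval (down z)) z0
  | Negz m => iter m.+1 (fun z => sval (up z)) z0
  end.
have stepW n : step (W (n + 1)) (W n).
  case: n => [m|[|m]].
  - by rewrite -PoszD addn1; apply: (svalP (down _)).
  - exact: (svalP (up _)).
  - have -> : Negz m.+1 + 1 = Negz m by rewrite !NegzE -addn1 PoszD opprD addrNK.
    exact: (svalP (up _)).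
(* [Q n] gets the sequence [W (n + 1 - 1) -> Q n -> W (n - 1)]. The unsimplified index makes the
   source of [i n] and the target of [p (n + 1)] agree syntactically, and the shift by one puts [X],
   that is [W 0], at the kernel of the differential of index [-1]. *)
have stepW' n : step (W (n + 1 - 1)) (W (n - 1)).
  by rewrite addrAC; apply: stepW.
have [Q dQ] : exists Q : int -> A, forall n, exists
    (i : mor (sval (W (n + 1 - 1))) (Q n)) (p : mor (Q n) (sval (W (n - 1)))),
    R (Q n) /\ ses i p.
  by have := choice _ stepW'.
have {}dQ n : {ip : mor (sval (W (n + 1 - 1))) (Q n) *
    mor (Q n) (sval (W (n - 1))) | R (Q n) /\ ses ip.1 ip.2}.
  apply: constructive_indefinite_description.
  by have [i [p ?]] := dQ n; exists (i, p).
pose i n := (sval (dQ n)).1; pose p n := (sval (dQ n)).2.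
have ip n : ses (i n) (p n) by have [] := svalP (dQ n).
have dd n : (i n \oc p (n + 1)) \oc (i (n + 1) \oc p (n + 1 + 1)) = 0.
  rewrite !comp_assoc (compm_eq _ (proj1 (proj1 (ip (n + 1))))).
  by rewrite compm0 comp0m.
exists (@Complex A Q (fun n => i n \oc p (n + 1)) dd); split=> [n|n|n|] /=.
- by have [] := svalP (dQ n).
- exists _, (i (n + 1)), (p (n + 1 + 1)); split=> //.
    apply/(kernel_mono_comp _ _ (kernel_mono (proj1 (ip n)))).
    by case: (ip (n + 1)).
  exact: cokernel_epi (proj2 (ip _)).
- have Fip m : ses (fmap F (i m)) (fmap F (p m)).
    by apply: Fses (ip m); apply: svalP.
  exists _, (fmap F (i (n + 1))), (fmap F (p (n + 1 + 1))).
  rewrite !fmap_comp; split=> //.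
    apply/(kernel_mono_comp _ _ (kernel_mono (proj1 (Fip n)))).
    by case: (Fip (n + 1)).
  exact: cokernel_epi (proj2 (Fip _)).
- exists (i (-1 + 1)).
  apply/(kernel_mono_comp _ _ (kernel_mono (proj1 (ip _)))).
  by case: (ip (-1 + 1)).
Qed.

(** * Almost split sequences under the Nakayama functor *)

Lemma pullback (A : preadditive) (abA : abelian_cat A) (L M N X : A)
    (f : mor L M) (g : mor M N) (h : mor X N) : ses f g ->
  exists E (b : mor L E) (e : mor E X) (w : mor E M),
    [/\ ses b e, w \oc b = f & g \oc w = h \oc e].
Proof.
move=> /op_ses fg.
have [E [e [b [w [/op_ses be gw wb]]]]] := pushout (op_abelian abA) h fg.
by exists E, b, e, w.
Qed.

Section NakayamaSequences.
Variable A : preadditive.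
Hypothesis abA : abelian_cat A.
Hypothesis ksA : krull_schmidt A.
Variables (nu num : functor A A) (a : adjunction nu num) (RP RI : A -> Prop).
Hypothesis gs : gorenstein_setting a RP RI.
Variables GP GI : A -> Prop.
Hypothesis GPE : forall X, GP X <-> sub_of RP X.
Hypothesis GIE : forall X, GI X <-> quot_of RI X.
Implicit Types L M N B E : A.

(** The transpose of a section of [num g], precomposed with the inverse of the counit at [N], is a
    section of [g]. *)
Lemma split_epi_num M N (g : mor M N) :
  quot_of RI N -> split_epi (fmap num g) -> split_epi g.
Proof.
move=> /(counit_iso abA gs) [c [_ ec]] [s gs1].
exists (adj_counit a M \oc fmap nu s \oc c).
rewrite !comp_assoc adj_counit_natural.
by rewrite -(comp_assoc _ (fmap nu _) (fmap nu s)) -fmap_comp gs1 fmap1 comp_idr.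
Qed.

(** With [c] inverse to the unit at [B], [num] of the transpose of [h] equals [h \oc c], so a
    section of the transpose yields one of [h]. *)
Lemma transpose_split_epi B N (h : mor B (num N)) : sub_of RP B ->
  split_epi (adj_counit a N \oc fmap nu h) -> split_epi h.
Proof.
move=> /(unit_iso abA gs) [c [_ uc]] [s hs]; exists (c \oc fmap num s).
rewrite -[RHS]fmap1 -hs !fmap_comp comp_assoc; congr (_ \oc _).
rewrite -[LHS]comp_idl -(triangle_right a) -comp_assoc; congr (_ \oc _).
by rewrite comp_assoc adj_unit_natural -comp_assoc uc comp_idr.
Qed.

Lemma num_right_almost_split M N (g : mor M N) :
  quot_of RI N -> right_almost_split (fun _ => True) g ->
  right_almost_split GP (fmap num g).
Proof.
move=> qN [nse ras]; split=> [/(split_epi_num qN)//|B h /GPE SB nh].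
have [|u gu] := ras _ (adj_counit a N \oc fmap nu h) I.
  by move/(transpose_split_epi SB).
exists (fmap num u \oc adj_unit a B).
rewrite comp_assoc -fmap_comp gu fmap_comp -comp_assoc -adj_unit_natural.
by rewrite comp_assoc triangle_right comp_idl.
Qed.

(** A factorization [u] of [h] through [g] passes through the counit at [M] by naturality, the
    counit at [B] being invertible. *)
Lemma counit_right_almost_split M N (g : mor M N) :
  quot_of RI N -> right_almost_split (fun _ => True) g ->
  right_almost_split GI (g \oc adj_counit a M).
Proof.
move=> qN [nse ras]; split=> [[s gs1]|B h /GIE qB nh].
  by apply: nse; exists (adj_counit a M \oc s); rewrite comp_assoc.
have [u gu] := ras B h I nh; have [c [_ ec]] := counit_iso abA gs qB.
exists (fmap nu (fmap num u) \oc c).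
by rewrite comp_assoc -(comp_assoc g) -adj_counit_natural comp_assoc gu
  -comp_assoc ec comp_idr.
Qed.

(** Pull back a conflation along a map from [N] that does not lift: a section of the pullback would
    provide a lift. *)
Lemma not_projective_in_ses N : quot_of RI N -> ~ projective_in GI N ->
  exists L E (b : mor L E) (e : mor E N),
    [/\ ses b e, quot_of RI L & ~ split_epi e].
Proof.
move=> qN np; apply: NNPP => no; apply: np; split; first exact/GIE.
move=> L M N' f g [/GIE qL _ _ /(short_exactP abA) fg] h.
have [E [b [e [w [be _ gw]]]]] := pullback abA h fg.
have [[s es]|ne] := classic (split_epi e).
  by exists (w \oc s); rewrite comp_assoc gw -comp_assoc es comp_idr.
by case: no; exists L, E, b, e.
Qed.

Lemma num_right_almost_split_epi M N (g : mor M N) :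
  quot_of RI N -> right_almost_split (fun _ => True) g ->
  ~ projective_in GI N -> epi (fmap num g).
Proof.
move=> qN rasg /(not_projective_in_ses qN) [L [E [b [e [be qL ne]]]]].
have [_ /cokernel_epi enume] := num_ses abA gs be qL.
have [_ ras] := num_right_almost_split qN rasg.
have [|/(split_epi_num qN)//|u gu] := ras (num E) (fmap num e).
  exact/GPE/(sub_of_num gs).
exact: epi_test enume gu.
Qed.

Lemma nakayama_almost_split L M N (f : mor L M) (g : mor M N) :
  almost_split_sequence (fun _ => True) f g -> GI N -> ~ projective_in GI N ->
  (short_exact (fmap num f) (fmap num g) /\
   almost_split_plus_left GP (fmap num f) (fmap num g)) /\
  (short_exact (fmap nu (fmap num f)) (g \oc adj_counit a M) /\
   almost_split_plus_left GI (fmap nu (fmap num f)) (g \oc adj_counit a M)).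
Proof.
move=> [[_ _ _ /(short_exactP abA) [ker _]] _ rasg] /GIE qN np.
have en := num_right_almost_split_epi qN rasg np.
have sn : ses (fmap num f) (fmap num g).
  have kn := right_adjoint_kernel a ker; split=> //; exact: epi_cokernel.
have [kc cc] : ses (fmap nu (fmap num f)) (fmap nu (fmap num g)).
  exact: (nu_ses abA gs sn (sub_of_num gs _)).
have ic := counit_iso abA gs qN.
(* By naturality of the counit this is [nu] of the previous sequence, its end term identified with
   [N] by the counit. *)
have sc : ses (fmap nu (fmap num f)) (g \oc adj_counit a M).
  rewrite adj_counit_natural.
  have kc' := proj2 (kernel_mono_comp _ _ (iso_mono ic)) kc.
  split=> //; apply: epi_cokernel => //.
  by apply: epi_comp (iso_epi ic) (cokernel_epi cc).
split; split; try exact/(short_exactP abA).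
- apply: almost_split_plus_leftP => //.
  + move=> K X Y k x s /GPE SK /GPE SY; apply/GPE.
    exact: (sub_of_extension abA gs s).
  + by move=> X Y r /GPE SY; apply/GPE/(sub_of_retract r).
  + exact/GPE/(sub_of_num gs).
  + exact/GPE/(sub_of_num gs).
  + exact: num_right_almost_split.
- apply: almost_split_plus_leftP => //.
  + move=> K X Y k x s /GIE SK /GIE SY; apply/GIE.
    exact: (quot_of_extension abA gs s).
  + by move=> X Y r /GIE SY; apply/GIE/(quot_of_retract r).
  + exact/GIE/(quot_of_nu gs).
  + exact/GIE.
  + exact: counit_right_almost_split.
Qed.

End NakayamaSequences.

(** * Transfer of the sequences to the opposite category *)

(** Dualizing swaps inclusions and projections, so a decomposition found in [op A] gives commuting
    squares with projections; this turns them into squares with inclusions. *)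
Lemma biproduct_map_inj (A : preadditive) (X1 X2 X Y1 Y2 Y : A)
    (i1 : mor X1 X) (i2 : mor X2 X) (p1 : mor X X1) (p2 : mor X X2)
    (j1 : mor Y1 Y) (j2 : mor Y2 Y) (q1 : mor Y Y1) (q2 : mor Y Y2)
    (f1 : mor X1 Y1) (f2 : mor X2 Y2) (f : mor X Y) :
  is_biproduct i1 i2 p1 p2 -> is_biproduct j1 j2 q1 q2 ->
  q1 \oc f = f1 \oc p1 -> q2 \oc f = f2 \oc p2 ->
  f \oc i1 = j1 \oc f1 /\ f \oc i2 = j2 \oc f2.
Proof.
move=> [a1 a2 a3 a4 _] [_ _ _ _ sum] e1 e2.
have -> : f = j1 \oc f1 \oc p1 + j2 \oc f2 \oc p2.
  by rewrite -!comp_assoc -e1 -e2 !comp_assoc -comp_addl sum comp_idl.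
rewrite !comp_addl (compm_eq _ a1) (compm_eq _ a2) (compm_eq _ a3).
by rewrite (compm_eq _ a4) !compm0 !comp_idr addr0 add0r.
Qed.

Lemma op_almost_split_plus_left (A : preadditive) (abA : abelian_cat A)
    (P : A -> Prop) (L M N : A) (f : mor L M) (g : mor M N) :
  almost_split_plus_left (A := op A) P (g : @mor (op A) N M) f ->
  almost_split_plus_right P f g.
Proof.
move=> [N1 [M1 [L1 [g1 [f1 [T [Z [[[PN PM PL s] lg rf] PT /op_zero Z0]]]]]]]].
move=> [iN1 [iN2 [pN1 [pN2 [iM1 [iM2 [pM1 [pM2 [iL1 [iL2 [pL1 [pL2]]]]]]]]]]]].
move=> [bN bM bL [eN1 eN2] [eM1 eM2]].
have bip X Y S i1 i2 p1 p2 : is_biproduct (A := op A) i1 i2 p1 p2 ->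
  @is_biproduct A X Y S p1 p2 i1 i2 by move=> [].
exists L1, M1, N1, f1, g1, T, Z; split=> //.
  split; [split=> //|exact: rf|exact: lg].
  exact: (proj1 (@op_short_exact A abA _ _ _ f1 g1) s).
exists pL1, pL2, iL1, iL2, pM1, pM2, iM1, iM2, pN1, pN2, iN1, iN2.
split; try exact: bip.
- exact: (biproduct_map_inj (bip _ _ _ _ _ _ _ bL) (bip _ _ _ _ _ _ _ bM)).
- exact: (biproduct_map_inj (bip _ _ _ _ _ _ _ bM) (bip _ _ _ _ _ _ _ bN)).
Qed.

Section DualSequences.
Variable A : preadditive.
Hypothesis abA : abelian_cat A.
Hypothesis ksA : krull_schmidt A.
Variables (nu num : functor A A) (a : adjunction nu num) (RP RI : A -> Prop).
Hypothesis gs : gorenstein_setting a RP RI.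
Variables GP GI : A -> Prop.
Hypothesis GPE : forall X, GP X <-> sub_of RP X.
Hypothesis GIE : forall X, GI X <-> quot_of RI X.

Lemma nakayama_almost_split_dual (L M N : A) (f : mor L M) (g : mor M N) :
  almost_split_sequence (fun _ => True) f g -> GP L -> ~ injective_in GP L ->
  (short_exact (fmap nu f) (fmap nu g) /\
   almost_split_plus_right GI (fmap nu f) (fmap nu g)) /\
  (short_exact (adj_unit a M \oc f) (fmap num (fmap nu g)) /\
   almost_split_plus_right GP (adj_unit a M \oc f) (fmap num (fmap nu g))).
Proof.
move=> [[_ _ _ s] lf rg] GL ni.
have [] := nakayama_almost_split (op_abelian abA) (op_krull_schmidt ksA)
  (op_gorenstein_setting gs) GIE GPE (f := g) (g := f) _ GL.
- split; [split=> // | exact: rg | exact: lf].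
  exact: (proj2 (op_short_exact abA f g) s).
- move=> [_ pr]; apply: ni; split=> // K X Y k x [PK PX PY sx].
  apply: (pr Y X K x k); split=> //.
  exact: (proj2 (op_short_exact abA k x) sx).
move=> [s1 p1] [s2 p2]; split; split.
- exact: (proj1 (op_short_exact abA _ _) s1).
- exact: (op_almost_split_plus_left abA p1).
- exact: (proj1 (op_short_exact abA _ _) s2).
- exact: (op_almost_split_plus_left abA p2).
Qed.

End DualSequences.

(** * Iwanaga-Gorenstein adjunctions *)

Section Resolutions.
Variable A : preadditive.
Hypothesis abA : abelian_cat A.
Variables (F : functor A A) (RP : A -> Prop).
Hypothesis F_cokernel : forall (X Y Q : A) (q : mor Y Q) (f : mor X Y),
  is_cokernel q f -> is_cokernel (fmap F q) (fmap F f).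
Hypothesis cover : forall X, exists P (p : mor P X), RP P /\ epi p.

(** Vanishing of the second left derived functor of [F], read off a resolution by [RP]. *)
Hypothesis F_exact2 : forall (X : A) (P : nat -> A)
  (d : forall m, mor (P m.+1) (P m)) (e : mor (P 0) X),
  (forall m, RP (P m)) -> epi e -> exact_at (d 0) e ->
  (forall m, exact_at (d m.+1) (d m)) ->
  exact_at (fmap F (d 2)) (fmap F (d 1)).

(* Splicing K -> P -> X -> Q with a resolution of K gives a resolution of
   coker m, whose second F-homology is the kernel of F i. *)
Lemma resolution_mono (K P X Q : A) (i : mor K P) (p : mor P X) (m : mor X Q) :
  RP P -> RP Q -> ses i p -> mono m -> mono (fmap F i).
Proof.
move=> RPP RQ [keri cokp] mm.
have step Z : {W : A * A & {kp : mor W.1 W.2 * mor W.2 Z |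
    RP W.2 /\ ses kp.1 kp.2}}.
  have : exists W : A * A, exists kp : mor W.1 W.2 * mor W.2 Z,
      RP W.2 /\ ses kp.1 kp.2.
    have [P' [p' [RP' ep']]] := cover Z; have [K' [k' s']] := epi_ses abA ep'.
    by exists (K', P'), (k', p').
  move=> /constructive_indefinite_description [W ex]; exists W.
  exact: constructive_indefinite_description.
pose W j := iter j (fun Z => (projT1 (step Z)).1) K.
pose C Z := (projT1 (step Z)).2.
pose k Z : mor _ (C Z) := (sval (projT2 (step Z))).1.
pose c Z : mor (C Z) Z := (sval (projT2 (step Z))).2.
have kc Z : ses (k Z) (c Z) by have [] := svalP (projT2 (step Z)).
pose PP j := match j with 0 => Q | 1 => P | j'.+2 => C (W j') end.
pose d j : mor (PP j.+1) (PP j) := match j with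
  | 0 => m \oc p
  | 1 => i \oc c K
  | j'.+2 => k (W j') \oc c (W j'.+1)
  end.
have [Y [y coky]] := has_cokernels abA m.
have splice X1 X2 X3 X4 (x : mor X1 X2) (u : mor X2 X3) (v : mor X3 X4) :
    epi x -> is_kernel u v -> exact_at (u \oc x) v by exists X2, u, x.
have kermc X1 X2 X3 X4 (u : mor X1 X2) (v : mor X2 X3) (w : mor X3 X4) :
    mono w -> is_kernel u v -> is_kernel u (w \oc v).
  by move=> mw /(kernel_mono_comp _ _ mw).
have ex1 : exact_at (fmap F (k K \oc c (W 1))) (fmap F (i \oc c K)).
  apply: (@F_exact2 Y PP d y).
  - by case=> [|[|j]] //=; have [] := svalP (projT2 (step (W j))).
  - exact: cokernel_epi coky.
  - apply: splice; [exact: cokernel_epi cokp|exact: mono_kernel].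
  - case=> [|[|j]] /=; apply: splice; try exact: cokernel_epi (proj2 (kc _)).
    + exact: kermc.
    + by apply: kermc (kernel_mono keri) _; case: (kc K).
    + by apply: kermc (kernel_mono (proj1 (kc _))) _; case: (kc (W j.+1)).
(* An element of [F K] killed by [F i] lifts to [F (C K)], where it is a cycle, hence a boundary;
   boundaries die in [F K] since [c K] kills [k K]. *)
apply: mono0P => T t it.
have Fc Z := F_cokernel (proj2 (kc Z)).
have [T1 [e1 [s1 [ee1 cs1]]]] := epi_lift abA t (cokernel_epi (Fc K)).
have [|T2 [e2 [s2 [ee2 es2]]]] := exact_lift abA (t := s1) ex1.
  by rewrite fmap_comp -comp_assoc cs1 comp_assoc it comp0m.
apply: (epi0 ee1); apply: (epi0 ee2).
rewrite -cs1 -comp_assoc -es2 comp_assoc -fmap_comp comp_assoc.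
by rewrite (ses_comp0 (kc K)) comp0m raddf0 comp0m.
Qed.

End Resolutions.

Lemma homology_exact (A : preadditive) (abA : abelian_cat A) (X Y Z : A)
    (f : mor X Y) (g : mor Y Z) :
  g \oc f = 0 -> (forall H, is_homology f g H -> is_zero H) -> exact_at f g.
Proof.
move=> gf0 hz; have [K [k ker]] := has_kernels abA g.
have [e ke] := kernel_lift ker gf0; have [H [c cok]] := has_cokernels abA e.
have [|_ H0] := hz H; first by exists K, k, e, c.
exists K, k, e; split=> //; apply: epi0P => T t te.
by have [u <-] := cokernel_desc cok te; rewrite (H0 _ u) comp0m.
Qed.

(** * The Gorenstein setting defined by a Nakayama functor *)

Section Nakayama.
Variables A C : preadditive.
Hypothesis abA : abelian_cat A.
Variables (fshriek : functor C A) (fstar : functor A C).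
Hypothesis faithful_fstar : faithful fstar.
Variables (adj : adjunction fshriek fstar) (N : nakayama adj).

Lemma add_imageP (F : functor C A) (X : A) :
  add_image F X <-> exists c, retract X (F c).
Proof.
split=> [[Y [c [[f iso] [Y' [i1 [_ [p1 [_ [pi _ _ _ _]]]]]]]]]|[c r]].
  by exists c; apply: retract_trans (iso_retract iso); exists i1, p1.
exists (F c), c; split; last exact: retract_summand.
by exists (idm _); apply: is_iso_id.
Qed.

Lemma rel_proj_cover X : exists P (p : mor P X), rel_proj fshriek P /\ epi p.
Proof.
exists (fshriek (fstar X)), (adj_counit adj X); split.
  by apply/add_imageP; exists (fstar X), (idm _), (idm _); rewrite comp_idl.
exact: faithful_counit_epi.
Qed.

Lemma rel_inj_envelope X : exists J (m : mor X J), rel_inj N J /\ mono m.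
Proof.
have [b] := nu_fshriek_right_adjoint N.
exists (fcomp (nu N) fshriek (fstar X)), (adj_unit b X); split.
  by apply/add_imageP; exists (fstar X), (idm _), (idm _); rewrite comp_idl.
exact: faithful_unit_mono.
Qed.

(** [nu] of the unit is invertible there, and a triangle identity makes the counit its inverse. *)
Lemma counit_nu_fshriek_iso c : is_iso (adj_counit (nu_adj N) (nu N (fshriek c))).
Proof.
have [w [wn nw]] := fmap_iso (nu N) (nu_unit_iso N c).
exists (fmap (nu N) (adj_unit (nu_adj N) (fshriek c))); split.
  have -> : adj_counit (nu_adj N) (nu N (fshriek c)) = w; last exact: nw.
  by rewrite -[LHS]comp_idr -nw comp_assoc triangle_left comp_idl.
exact: triangle_left.
Qed.

Hypothesis vanish : derived_vanish_above N 1.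

Lemma nakayama_setting :
  gorenstein_setting (nu_adj N) (rel_proj fshriek) (rel_inj N).
Proof.
split.
- exact: rel_proj_cover.
- exact: rel_inj_envelope.
- move=> P /add_imageP [c r]; apply/add_imageP; exists c.
  exact: retract_fmap r.
- move=> J /add_imageP [c r]; apply/add_imageP; exists c.
  apply: retract_trans (retract_fmap (num N) r) _.
  exact: iso_retract_sym (nu_unit_iso N c).
- move=> P /add_imageP [c r]; apply: (unit_iso_retract r).
  exact: nu_unit_iso.
- move=> J /add_imageP [c r]; apply: (counit_iso_retract r).
  exact: counit_nu_fshriek_iso.
- apply: (resolution_mono abA).
  + exact: left_adjoint_cokernel (nu_adj N).
  + exact: rel_proj_cover.
  move=> X P d e RP ee ex0 ex; apply: (homology_exact abA).
    by rewrite -fmap_comp (exact_compm0 (ex 1)) raddf0.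
  (* Degree 2 is the first one above dimension 1. *)
  by move=> H hH; apply: (proj1 (@vanish 2 X H isT)); exists P, d, e.
- move=> K P X Q i p m rP rQ /op_ses s em.
  apply: (@resolution_mono _ (op_abelian abA) (op_functor (num N)) (rel_inj N)
    _ _ _ K P X Q i p m rP rQ s em).
  + exact: (left_adjoint_cokernel (op_adjunction (nu_adj N))).
  + exact: rel_inj_envelope.
  move=> {K P X Q i p m rP rQ s em}.
  move=> X P d e RP ee /(op_exact abA) ex0 ex'; apply: (exact_op abA).
  have ex m := op_exact abA (ex' m).
  apply: (homology_exact abA).
    by rewrite -fmap_comp (exact_compm0 (ex 1)) raddf0.
  by move=> H hH; apply: (proj2 (@vanish 2 X H isT)); exists P, d, e.
Qed.

(** A kernel in a complex of relative projectives is a subobject of one. Conversely, subobjects have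
    syzygies and cosyzygies of the same kind, and [nu] is exact on the resulting short exact
    sequences. *)
Lemma GprojE X : Gproj N X <-> sub_of (rel_proj fshriek) X.
Proof.
have gs := nakayama_setting.
split=> [[Q [RQ _ _ [k ker]]]|SX].
  by exists (Q (-1 + 1)), k; split=> //; apply: kernel_mono ker.
apply: (complete_resolution (F := nu N) _ _ _ SX).
- by move=> Y _; apply: (sub_of_syzygy abA gs).
- exact: (sub_of_cosyzygy abA gs).
- by move=> K M L f g _ SL s; apply: (nu_ses abA gs s SL).
Qed.

Lemma GinjE X : Ginj N X <-> quot_of (rel_inj N) X.
Proof.
have gs := nakayama_setting.
split=> [[J [RJ ex _ [k ker]]]|SX].
  (* By exactness the kernel of the differential of index [-1] is the image of the term in degree 1,
     which therefore maps onto [X]. *)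
  have [K [k' [e [ker' ee _]]]] := ex (-1).
  have [u ku] := kernel_lift ker (proj1 ker').
  exists (J (-1 + 1 + 1)), (u \oc e); split=> //; apply: epi_comp => //.
  have [v kv] := kernel_lift ker' (proj1 ker).
  apply: iso_epi; exists v; split.
    by apply: (kernel_mono ker'); rewrite comp_assoc kv ku comp_idr.
  by apply: (kernel_mono ker); rewrite comp_assoc ku kv comp_idr.
apply: (complete_resolution (F := num N) _ _ _ SX).
- exact: (quot_of_syzygy abA gs).
- by move=> Y _; apply: (quot_of_cosyzygy abA gs).
- by move=> K M L f g SL _ s; apply: (num_ses abA gs s SL).
Qed.

End Nakayama.

Theorem corollary6p15 (A C : preadditive)
  (abA : abelian_cat A) (abC : abelian_cat C) (ksA : krull_schmidt A)
  (fshriek : functor C A) (fstar : functor A C) (faithful_fstar : faithful fstar)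
  (adj : adjunction fshriek fstar) (N : nakayama adj)
  (n : nat) (le_n1 : (n <= 1)%N) (igN : iwanaga_gorenstein_dim N n)
  (A2 A0 A1 : A) (g' : mor A2 A0) (g : mor A0 A1)
  (asg : almost_split_sequence (fun _ : A => True) g' g) :
  (* (i) *)
  (Ginj N A1 -> indecomposable A1 -> ~ projective_in (Ginj N) A1 ->
    short_exact (fmap (num N) g') (fmap (num N) g) /\
    almost_split_plus_left (Gproj N) (fmap (num N) g') (fmap (num N) g)) /\
  (* (ii) *)
  (Ginj N A1 -> indecomposable A1 -> ~ projective_in (Ginj N) A1 ->
    short_exact (fmap (nu N) (fmap (num N) g'))
                (g \oc adj_counit (nu_adj N) A0) /\
    almost_split_plus_left (Ginj N) (fmap (nu N) (fmap (num N) g'))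
                           (g \oc adj_counit (nu_adj N) A0)) /\
  (* dual of (i) *)
  (Gproj N A2 -> indecomposable A2 -> ~ injective_in (Gproj N) A2 ->
    short_exact (fmap (nu N) g') (fmap (nu N) g) /\
    almost_split_plus_right (Ginj N) (fmap (nu N) g') (fmap (nu N) g)) /\
  (* dual of (ii) *)
  (Gproj N A2 -> indecomposable A2 -> ~ injective_in (Gproj N) A2 ->
    short_exact (adj_unit (nu_adj N) A0 \oc g')
                (fmap (num N) (fmap (nu N) g)) /\
    almost_split_plus_right (Gproj N) (adj_unit (nu_adj N) A0 \oc g')
                            (fmap (num N) (fmap (nu N) g))).
Proof.
have [vanish _] := igN.
have van1 : derived_vanish_above N 1.
  by move=> j X H lt1j; apply: vanish; apply: leq_ltn_trans le_n1 lt1j.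
have gs := nakayama_setting abA faithful_fstar van1.
have GPE := GprojE abA faithful_fstar van1.
have GIE := GinjE abA faithful_fstar van1.
have l := nakayama_almost_split abA ksA gs GPE GIE asg.
have r := nakayama_almost_split_dual abA ksA gs GPE GIE asg.
split; [|split; [|split]] => G _ np.
- by case: (l G np).
- by case: (l G np).
- by case: (r G np).
- by case: (r G np).
Qed.
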